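(* The following hold for each $m\ge 1$. (i) $\mathrm{CL}(m)$ is contained in, but not equal to, the class of $G_{\delta\sigma}$ subsets of $S^m$. (ii) The class of $G_\delta$ subsets of $S^m$ is contained in, but not equal to, $\mathrm{CL}(m)$. (iii) Let $Y$ be a sphere of codimension one in $S^m$. Then $\mathrm{CL}(m)$ contains all $G_{\delta\sigma}$ subsets of $Y$. (iv) $\mathrm{CL}(m)$ is not invariant under homeomorphisms of $S^m$; that is, there are a homeomorphism $f:S^m\to S^m$ and a set $A\in\mathrm{CL}(m)$ with $f(A)\notin\mathrm{CL}(m)$.
   Context: $H^{m+1}$ denotes $(m+1)$-dimensional hyperbolic space with hyperbolic distance $\rho$, and $S^m=\partial H^{m+1}$ its ideal boundary sphere (in the Poincaré ball model, the unit sphere bounding the open unit ball). A sequence $(z_n)$ in $H^{m+1}$ converges ideally to $x\in S^m$ if it converges to $x$ in the Euclidean topology of the closed unit ball. It converges conically to $x\in S^m$ if it converges ideally to $x$ and there is a geodesic ray $\gamma$ in $H^{m+1}$ landing at $x$ such that the distances $\rho(z_n,\gamma)$ are bounded. For $E\subseteq H^{m+1}$, the conical limit set $\Lambda_c(E)$ is the set of all $x\in S^m$ for which there is a sequence of points of $E$ converging conically to $x$. $\mathrm{CL}(m)=\{\Lambda_c(E): E\subseteq H^{m+1}\}$ is the class of all subsets of $S^m$ that arise as conical limit sets. A $G_\delta$ set is a countable intersection of open sets; a $G_{\delta\sigma}$ set is a countable union of $G_\delta$ sets. A sphere of codimension one in $S^m$ means a round sphere of dimension $m-1$, i.e. the image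 under a Möbius map of an equatorial $S^{m-1}\subset S^m$. *)

(* Defs.v *)
From HB Require Import structures.
From mathcomp Require Import all_boot all_order all_algebra.
From mathcomp Require Import all_classical all_reals all_analysis.
From mathcomp Require Import borel_hierarchy.

Set Implicit Arguments.
Unset Strict Implicit.
Unset Printing Implicit Defensive.

Import Order.TTheory GRing.Theory Num.Theory.
Import numFieldNormedType.Exports.

Local Open Scope classical_set_scope.
Local Open Scope ring_scope.

(* [`|x|] on row vectors is the sup norm, so the Euclidean norm is defined
   here; both induce the library topology of ['rV[R]_n]. *)
Definition edot (R : realType) (n : nat) (u v : 'rV[R]_n) : R :=
  \sum_i u 0 i * v 0 i.

Definition enorm (R : realType) (n : nat) (u : 'rV[R]_n) : R :=
  Num.sqrt (edot u u).

(* Poincare ball model of H^(m+1) and its ideal boundary S^m, in R^(m+1). *)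
Definition hspace (R : realType) (m : nat) : set 'rV[R]_m.+1 :=
  [set z | enorm z < 1].

Definition ideal_sphere (R : realType) (m : nat) : set 'rV[R]_m.+1 :=
  [set x | enorm x = 1].

Arguments hspace R m : clear implicits.
Arguments ideal_sphere R m : clear implicits.

Definition arcosh (R : realType) (t : R) : R := ln (t + Num.sqrt (t ^+ 2 - 1)).

(* Distance of the metric 2|dx|/(1-|x|^2), of constant curvature -1;
   meaningful on [hspace R m] only. *)
Definition hdist (R : realType) (m : nat) (z w : 'rV[R]_m.+1) : R :=
  arcosh (1 + 2 * enorm (z - w) ^+ 2
                / ((1 - enorm z ^+ 2) * (1 - enorm w ^+ 2))).

Definition hdist_set (R : realType) (m : nat) (z : 'rV[R]_m.+1)
    (A : set 'rV[R]_m.+1) : R :=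
  inf [set hdist z w | w in A].

(* Unit-speed parametrisation; values at negative times are irrelevant. *)
Definition geodesic_ray (R : realType) (m : nat) (g : R -> 'rV[R]_m.+1) : Prop :=
  (forall t, 0 <= t -> hspace R m (g t)) /\
  (forall s t, 0 <= s -> 0 <= t -> hdist (g s) (g t) = `|s - t|).

Definition ray_set (R : realType) (m : nat) (g : R -> 'rV[R]_m.+1) :
    set 'rV[R]_m.+1 :=
  [set g t | t in [set t | 0 <= t]].

Definition lands_at (R : realType) (m : nat) (g : R -> 'rV[R]_m.+1)
    (x : 'rV[R]_m.+1) : Prop :=
  g t @[t --> +oo] --> x.

Definition converges_ideally (R : realType) (m : nat)
    (z : nat -> 'rV[R]_m.+1) (x : 'rV[R]_m.+1) : Prop :=
  z n @[n --> \oo] --> x.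

Definition converges_conically (R : realType) (m : nat)
    (z : nat -> 'rV[R]_m.+1) (x : 'rV[R]_m.+1) : Prop :=
  converges_ideally z x /\
  exists g : R -> 'rV[R]_m.+1,
    [/\ geodesic_ray g, lands_at g x &
        exists M : R, forall n, hdist_set (z n) (ray_set g) <= M].

Definition conical_limit_set (R : realType) (m : nat)
    (E : set 'rV[R]_m.+1) : set 'rV[R]_m.+1 :=
  [set x | ideal_sphere R m x /\
           exists2 z : nat -> 'rV[R]_m.+1,
             (forall n, E (z n)) & converges_conically z x].

Definition CL (R : realType) (m : nat) : set (set 'rV[R]_m.+1) :=
  [set conical_limit_set E | E in [set E | E `<=` hspace R m]].

Arguments CL R m : clear implicits.

(* G_delta subsets of the space X with its relative topology.  Points outside
   X are isolated in [subspace X], hence the explicit inclusion in X. *)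
Definition Gdelta_in (T : topologicalType) (X : set T) : set (set T) :=
  [set A | A `<=` X /\ Gdelta (A : set (subspace X))].

Definition Gdelta_sigma_in (T : topologicalType) (X : set T) : set (set T) :=
  [set A | exists2 F : (set T)^nat,
             (forall i, Gdelta_in X (F i)) & A = \bigcup_i F i].

Definition self_homeomorphism (T : topologicalType) (X : set T) (f : T -> T) :
    Prop :=
  [/\ set_bij X X f, {within X, continuous f} &
      exists g : T -> T,
        [/\ (forall x, X x -> X (g x) /\ f (g x) = x),
            (forall x, X x -> g (f x) = x) & {within X, continuous g}]].

Definition hyperplane_reflection (R : realType) (m : nat)
    (a x : 'rV[R]_m.+1) : 'rV[R]_m.+1 :=
  x - (2 * edot x a / edot a a) *: a.

Definition sphere_inversion (R : realType) (m : nat)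
    (a : 'rV[R]_m.+1) (r : R) (x : 'rV[R]_m.+1) : 'rV[R]_m.+1 :=
  a + (r ^+ 2 / enorm (x - a) ^+ 2) *: (x - a).

(* Moebius maps of S^m: the group generated by inversions in the hyperplanes
   and the Euclidean spheres of R^(m+1) orthogonal to S^m.  A sphere with
   centre a and radius r is orthogonal to S^m iff |a|^2 = 1 + r^2.  Only the
   restriction of f to S^m matters; the centre a lies off S^m. *)
Inductive moebius (R : realType) (m : nat) :
    ('rV[R]_m.+1 -> 'rV[R]_m.+1) -> Prop :=
| moebius_id : moebius id
| moebius_reflection a f :
    a != 0 -> moebius f -> moebius (hyperplane_reflection a \o f)
| moebius_inversion a r f :
    0 < r -> enorm a ^+ 2 = 1 + r ^+ 2 -> moebius f ->
    moebius (sphere_inversion a r \o f).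

Definition equatorial_sphere (R : realType) (m : nat) (a : 'rV[R]_m.+1) :
    set 'rV[R]_m.+1 :=
  ideal_sphere R m `&` [set x | edot x a = 0].

Definition codim1_sphere (R : realType) (m : nat) (Y : set 'rV[R]_m.+1) : Prop :=
  exists a f, [/\ a != 0, moebius f & Y = f @` equatorial_sphere a].

(* Main.v *)
Require Import Defs.
From HB Require Import structures.
From mathcomp Require Import all_boot all_order all_algebra.
From mathcomp Require Import all_classical all_reals all_analysis.
From mathcomp Require Import borel_hierarchy ring lra.

Set Implicit Arguments.
Unset Strict Implicit.
Unset Printing Implicit Defensive.

Import Order.TTheory GRing.Theory Num.Theory.
Import numFieldNormedType.Exports.

Local Open Scope classical_set_scope.
Local Open Scope ring_scope.

(** The proof rests on a Euclidean description of conical limit sets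
    ([conical_limitP]): [x] is a conical limit point of [E] iff for some [C] there
    are points [z] of [E] arbitrarily close to [x] with
    [enorm (z - x) <= C * (1 - enorm z)].  A geodesic ray stays in such a cone at
    its endpoint, and bounded hyperbolic neighbourhoods only widen the cone.

    For fixed [C] the condition is G-delta in [x], which gives the first inclusion.
    Conversely, sets are realized by a single construction,
    [conical_limit_realization].  A G-delta set that is the intersection of open
    sets [U k] is reached from points over [U k] whose height is small compared
    with their distance to the complement of [U k], so that no boundary point of
    [U k] is reached conically.  For a countable union of such sets the j-th family
    has to be approached in cones whose aperture tends to infinity with [j], so
    that different families do not interact; this is possible when the sets lie in
    a closed set [Y] with enough holes.  A sphere of codimension one is a plane
    section of the sphere [S^m] and has holes on both sides at every scale.

    For the last part, let [A] be the set of numbers with a finite decimal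
    expansion with digits -1, 0 and 1.  It has holes of size comparable to the
    distance at all of its points, so that the points of the sphere with first
    coordinate in [A] form a conical limit set ([decimals_CL]).  A homeomorphism [h]
    of [-1, 1] is built as a sum of translates of an odd function close to
    [1 / ln (1 / t)]; at each point of [A] it makes all the holes negligible.  For
    the image set a category argument applies ([nonporous_not_CL]): since any
    ball near one of its points, of radius comparable to the distance to that point,
    meets the set, a set [E] with this conical limit set would have conical limit
    points with aperture 3 at a generic point of the closure, while the image set
    is meager in its closure.

    The two strict inclusions follow, as the classes of G-delta and G-delta-sigma
    subsets of the sphere are invariant under its homeomorphisms. *)

(** * Euclidean norm on row vectors *)

Lemma edotC {R : realType} n (u v : 'rV[R]_n) : edot u v = edot v u.
Proof. by apply: eq_bigr => i _; rewrite mulrC. Qed.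

Lemma edotDl {R : realType} n (u v w : 'rV[R]_n) :
  edot (u + v) w = edot u w + edot v w.
Proof.
by rewrite /edot -big_split; apply: eq_bigr => i _; rewrite mxE mulrDl.
Qed.

Lemma edotZl {R : realType} n (a : R) (u w : 'rV[R]_n) :
  edot (a *: u) w = a * edot u w.
Proof. by rewrite /edot mulr_sumr; apply: eq_bigr => i _; rewrite mxE mulrA. Qed.

Lemma edotNl {R : realType} n (u w : 'rV[R]_n) : edot (- u) w = - edot u w.
Proof. by rewrite -scaleN1r edotZl mulN1r. Qed.

Lemma edotDr {R : realType} n (u v w : 'rV[R]_n) :
  edot w (u + v) = edot w u + edot w v.
Proof. by rewrite edotC edotDl !(edotC w). Qed.

Lemma edotZr {R : realType} n (a : R) (u w : 'rV[R]_n) :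
  edot w (a *: u) = a * edot w u.
Proof. by rewrite edotC edotZl edotC. Qed.

Lemma edotNr {R : realType} n (u w : 'rV[R]_n) : edot w (- u) = - edot w u.
Proof. by rewrite edotC edotNl edotC. Qed.

Definition edotE :=
  (@edotDl, @edotDr, @edotNl, @edotNr, @edotZl, @edotZr).

Lemma edot_ge0 {R : realType} n (u : 'rV[R]_n) : 0 <= edot u u.
Proof. by apply: sumr_ge0 => i _; rewrite -expr2 sqr_ge0. Qed.

Lemma edot_eq0 {R : realType} n (u : 'rV[R]_n) : (edot u u == 0) = (u == 0).
Proof.
apply/eqP/eqP => [/eqP|->]; last by rewrite /edot big1// => i _; rewrite mxE mul0r.
rewrite psumr_eq0 => [/allP u0|i _]; last by rewrite -expr2 sqr_ge0.
apply/rowP => i; rewrite mxE.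
by have /implyP/(_ isT) := u0 i (mem_index_enum _); rewrite -expr2 sqrf_eq0 => /eqP.
Qed.

Lemma enorm_sqr {R : realType} n (u : 'rV[R]_n) : enorm u ^+ 2 = edot u u.
Proof. by rewrite sqr_sqrtr// edot_ge0. Qed.

Lemma enorm_ge0 {R : realType} n (u : 'rV[R]_n) : 0 <= enorm u.
Proof. exact: sqrtr_ge0. Qed.

Lemma enorm_eq0 {R : realType} n (u : 'rV[R]_n) : (enorm u == 0) = (u == 0).
Proof. by rewrite -sqrf_eq0 enorm_sqr edot_eq0. Qed.

Lemma enorm0 {R : realType} n : enorm (0 : 'rV[R]_n) = 0.
Proof. by apply/eqP; rewrite enorm_eq0. Qed.

Lemma enormN {R : realType} n (u : 'rV[R]_n) : enorm (- u) = enorm u.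
Proof. by rewrite /enorm edotNl edotNr opprK. Qed.

Lemma enormZ {R : realType} n (a : R) (u : 'rV[R]_n) :
  enorm (a *: u) = `|a| * enorm u.
Proof.
by rewrite /enorm edotZl edotZr mulrA -expr2 sqrtrM ?sqr_ge0// sqrtr_sqr.
Qed.

Lemma edistC {R : realType} n (u v : 'rV[R]_n) : enorm (u - v) = enorm (v - u).
Proof. by rewrite -enormN opprB. Qed.

Lemma ler_edot {R : realType} n (u v : 'rV[R]_n) : `|edot u v| <= enorm u * enorm v.
Proof.
have [->|v0] := eqVneq v 0.
  by rewrite -(scale0r u) edotZr mul0r normr0 mulr_ge0 ?enorm_ge0.
have vv : 0 < edot v v by rewrite lt_neqAle eq_sym edot_eq0 v0 edot_ge0.
rewrite -(@ler_pXn2r _ 2)// ?nnegrE ?mulr_ge0 ?enorm_ge0//.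
rewrite exprMn !enorm_sqr real_normK ?num_real//.
have := edot_ge0 (edot v v *: u - edot u v *: v).
rewrite !edotE (edotC v u) => h.
rewrite -subr_ge0 -(pmulr_rge0 _ vv).
by apply: le_trans h _; rewrite le_eqVlt; apply/orP; left; apply/eqP; ring.
Qed.

Lemma enormD {R : realType} n (u v : 'rV[R]_n) : enorm (u + v) <= enorm u + enorm v.
Proof.
rewrite -(@ler_pXn2r _ 2)// ?nnegrE ?addr_ge0 ?enorm_ge0//.
rewrite enorm_sqr sqrrD !enorm_sqr !edotE (edotC v u).
have := ler_edot u v; rewrite ler_norml => /andP[_]; lra.
Qed.

Lemma edist_trans {R : realType} n (v u w : 'rV[R]_n) :
  enorm (u - w) <= enorm (u - v) + enorm (v - w).
Proof. by apply: le_trans (enormD _ _); rewrite addrA subrK. Qed.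

Lemma ler_enorm_dist {R : realType} n (u v : 'rV[R]_n) :
  enorm u - enorm v <= enorm (u - v).
Proof. by rewrite lerBlDr; apply: le_trans (enormD _ _); rewrite subrK. Qed.

Lemma coord_le_enorm {R : realType} n (u : 'rV[R]_n) i : `|u 0 i| <= enorm u.
Proof.
rewrite -(@ler_pXn2r _ 2)// ?nnegrE ?enorm_ge0// enorm_sqr real_normK ?num_real//.
rewrite /edot (bigD1 i)//= -expr2 lerDl.
by apply: sumr_ge0 => j _; rewrite -expr2 sqr_ge0.
Qed.

Lemma enorm_le_coord {R : realType} n (u : 'rV[R]_n) (e : R) :
  (forall i, `|u 0 i| <= e) -> enorm u <= n%:R * e.
Proof.
move=> ue; case: n u ue => [|n] u ue.
  by rewrite mul0r (_ : u = 0) ?enorm0//; apply/rowP => -[].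
have e0 : 0 <= e by apply: le_trans (ue ord0).
rewrite -(@ler_pXn2r _ 2)// ?nnegrE ?mulr_ge0 ?enorm_ge0// enorm_sqr.
apply: (@le_trans _ _ (\sum_(i < n.+1) e ^+ 2)).
  apply: ler_sum => i _; rewrite -expr2 -(real_normK (num_real _)).
  by rewrite ler_pXn2r// ?nnegrE.
rewrite sumr_const card_ord exprMn -[leLHS]mulr_natl ler_wpM2r ?sqr_ge0//.
by rewrite -natrX ler_nat -[X in (X <= _)%N]expn1 leq_pexp2l.
Qed.

(** The topology is that of the sup norm, whose balls are comparable to the
    Euclidean ones up to the factor [n.+1]. *)
Lemma nbhs_enormP {R : realType} n (x : 'rV[R]_n) (A : set 'rV[R]_n) :
  nbhs x A <-> exists2 e : R, 0 < e & forall y, enorm (y - x) < e -> A y.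
Proof.
split=> [/nbhs_ballP[e /= e0 eA]|[e e0 eA]].
  exists e => // y yx; apply: eA; split=> // i j.
  rewrite /ball/= distrC; apply: le_lt_trans yx.
  by rewrite (ord1 i) (_ : y 0 j - x 0 j = (y - x) 0 j) ?coord_le_enorm// !mxE.
apply/nbhs_ballP; exists (e / n.+1%:R) => /=; first by rewrite divr_gt0.
move=> y [_ xy]; apply: eA; apply: (@le_lt_trans _ _ (n%:R * (e / n.+1%:R))).
  apply: enorm_le_coord => i; have := xy 0 i.
  by rewrite /ball/= distrC !mxE => /ltW.
rewrite mulrA ltr_pdivrMr// mulrC ltr_pM2l// ltr_nat//.
Qed.

Lemma cvg_enormP {R : realType} n (T : Type) (F : set_system T) {FF : Filter F}
    (f : T -> 'rV[R]_n) (x : 'rV[R]_n) :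
  f @ F --> x <-> forall e : R, 0 < e -> \forall t \near F, enorm (f t - x) < e.
Proof.
split=> [fx e e0|fx A /nbhs_enormP[e e0 eA]].
  by apply: (fx [set y | enorm (y - x) < e]); apply/nbhs_enormP; exists e.
by apply: filterS (fx e e0) => t; exact: eA.
Qed.

Lemma open_enormP {R : realType} n (A : set 'rV[R]_n) :
  open A <-> forall x, A x ->
    exists2 e : R, 0 < e & forall y, enorm (y - x) < e -> A y.
Proof.
rewrite openE; split=> oA x Ax; first exact/nbhs_enormP/oA.
exact/nbhs_enormP/oA.
Qed.

Lemma within_continuous_enormP {R : realType} n (X : set 'rV[R]_n)
    (f : 'rV[R]_n -> 'rV[R]_n) :
  {within X, continuous f} <->
  forall x, X x -> forall e : R, 0 < e -> exists2 d : R, 0 < d &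
    forall y, X y -> enorm (y - x) < d -> enorm (f y - f x) < e.
Proof.
split=> [/subspace_continuousP cf x Xx e e0|cf].
  have /cvg_enormP/(_ e e0) := cf x Xx.
  rewrite near_withinE => /nbhs_enormP[d d0 dH].
  by exists d => // y Xy /dH/(_ Xy).
apply/subspace_continuousP => x Xx; apply/cvg_enormP => e /(cf x Xx)[d d0 dH].
by rewrite near_withinE; apply/nbhs_enormP; exists d => // y yd Xy; apply: dH.
Qed.

(** * Conical convergence in Euclidean terms *)

Lemma arcosh_ge0 {R : realType} (t : R) : 1 <= t -> 0 <= arcosh t.
Proof. by move=> t1; apply: ln_ge0; have := sqrtr_ge0 (t ^+ 2 - 1); lra. Qed.

Lemma arcosh_le {R : realType} (s t : R) : 1 <= s -> s <= t -> arcosh s <= arcosh t.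
Proof.
move=> s1 st; have hs := sqrtr_ge0 (s ^+ 2 - 1); have ht := sqrtr_ge0 (t ^+ 2 - 1).
rewrite ler_ln ?posrE; [|lra..].
by rewrite lerD// ler_wsqrtr// lerB// ler_pXn2r// nnegrE; lra.
Qed.

Lemma expR_arcosh {R : realType} (t : R) : 1 <= t ->
  expR (arcosh t) = t + Num.sqrt (t ^+ 2 - 1).
Proof. by move=> t1; rewrite lnK// posrE; have := sqrtr_ge0 (t ^+ 2 - 1); lra. Qed.

Lemma arcoshK {R : realType} (t : R) : 1 <= t ->
  expR (arcosh t) + expR (- arcosh t) = 2 * t.
Proof.
move=> t1; have E0 := expR_gt0 (arcosh t).
have h : (expR (arcosh t) - t) ^+ 2 = t ^+ 2 - 1.
  by rewrite expR_arcosh// addrAC subrr add0r sqr_sqrtr// subr_ge0 expr_ge1//; lra.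
apply: (mulfI (lt0r_neq0 E0)); rewrite mulrDr expRxMexpNx_1.
by move: h; rewrite sqrrB => h; rewrite expr2 in h; lra.
Qed.

Lemma arcosh_cosh {R : realType} (a b : R) : 0 < a -> 0 < b ->
  arcosh ((a / b + b / a) / 2) = `|ln a - ln b|.
Proof.
wlog ab : a b / b <= a => [hw a0 b0|a0 b0].
  have [/hw|/ltW/hw] := leP b a; first exact.
  by rewrite distrC addrC; apply.
rewrite ger0_norm; last by rewrite subr_ge0 ler_ln.
have ba : b / a <= a / b by rewrite ler_pdivrMr// mulrAC ler_pdivlMr//; nra.
rewrite -ln_div ?posrE// /arcosh; congr ln.
rewrite (_ : _ ^+ 2 - 1 = ((a / b - b / a) / 2) ^+ 2); last by field; rewrite !gt_eqF.
rewrite sqrtr_sqr ger0_norm; last lra.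
by field; rewrite !gt_eqF.
Qed.

Lemma hspace_lt1 {R : realType} m (z : 'rV[R]_m.+1) :
  hspace R m z -> 0 < 1 - enorm z ^+ 2.
Proof. by rewrite subr_gt0 => z1; rewrite expr_lt1// enorm_ge0. Qed.

Lemma hdist_arg_ge1 {R : realType} m (z w : 'rV[R]_m.+1) :
  hspace R m z -> hspace R m w ->
  1 <= 1 + 2 * enorm (z - w) ^+ 2 / ((1 - enorm z ^+ 2) * (1 - enorm w ^+ 2)).
Proof.
move=> /hspace_lt1 z1 /hspace_lt1 w1.
by rewrite lerDl; apply: divr_ge0; apply: mulr_ge0; rewrite ?sqr_ge0// ltW.
Qed.

(** The hyperbolic distance [t - s] determines the Euclidean length of the chord
    from the distances of its endpoints to the sphere; the first factor on the
    right is [4 * sinh ((t - s) / 2) ^+ 2]. *)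
Lemma ray_chord {R : realType} m (g : R -> 'rV[R]_m.+1) s t :
  geodesic_ray g -> 0 <= s -> s <= t ->
  4 * enorm (g s - g t) ^+ 2 =
  (expR t / expR s + expR s / expR t - 2) *
    ((1 - enorm (g s) ^+ 2) * (1 - enorm (g t) ^+ 2)).
Proof.
move=> [gH gd] s0 st; have t0 := le_trans s0 st.
have [hs ht] := (gH _ s0, gH _ t0).
have := arcoshK (hdist_arg_ge1 hs ht); rewrite -/(hdist _ _) gd//.
rewrite distrC ger0_norm ?subr_ge0//.
rewrite opprB !expRB.
move: (hspace_lt1 hs) (hspace_lt1 ht); set a := 1 - _; set b := 1 - _ => a0 b0.
by move=> ->; field; rewrite !gt_eqF// expR_gt0.
Qed.

Lemma ray_chord_le {R : realType} m (g : R -> 'rV[R]_m.+1) s t :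
  geodesic_ray g -> 0 <= s -> s <= t ->
  enorm (g s - g t) ^+ 2 * (1 - enorm (g 0) ^+ 2) * expR s <=
  4 * (1 - enorm (g s) ^+ 2).
Proof.
move=> gr s0 st; have t0 := le_trans s0 st.
have h1 := ray_chord gr s0 st; have h2 := ray_chord gr (lexx 0) t0.
have a0 := hspace_lt1 (gr.1 _ (lexx 0)).
have as0 := hspace_lt1 (gr.1 _ s0); have at0 := hspace_lt1 (gr.1 _ t0).
have g0t : enorm (g 0 - g t) ^+ 2 <= 4.
  have := enormD (g 0) (- g t); rewrite enormN.
  have /= := gr.1 _ (lexx 0); have /= := gr.1 _ t0; rewrite /hspace/=.
  by move: (enorm_ge0 (g 0 - g t)); set u := enorm (_ - _); nra.
have es : 1 <= expR s by rewrite -expR0 ler_expR.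
have est : expR s <= expR t by rewrite ler_expR.
move: h1 h2; rewrite expR0 invr1 mulr1 mul1r.
move: g0t a0 as0 at0 es est.
set c := enorm (g 0 - g t) ^+ 2; set d := enorm (g s - g t) ^+ 2.
set a := 1 - _; set b := 1 - _; set e := 1 - _.
set x := expR s; set y := expR t => c4 a0 b0 e0 x1 xy h1 h2.
have x0 : 0 < x by lra.
have y0 : 0 < y by lra.
(* sinh ((t - s) / 2) ^ 2 <= exp (- s) * sinh (t / 2) ^ 2 *)
have k : (y / x + x / y - 2) * x <= y + y^-1 - 2.
  rewrite -subr_ge0 (_ : _ - _ = (x - 1) * (2 * y - x - 1) / y); last by field; rewrite !gt_eqF.
  by rewrite divr_ge0 ?mulr_ge0//; lra.
have : 4 * (d * a * x) <= 4 * (c * b).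
  rewrite (_ : 4 * (d * a * x) = (4 * d) * a * x); last by ring.
  rewrite (_ : 4 * (c * b) = (4 * c) * b); last by ring.
  rewrite h1 h2.
  rewrite [leLHS](_ : _ = (y / x + x / y - 2) * x * (a * b * e)); last by ring.
  rewrite [leRHS](_ : _ = (y + y^-1 - 2) * (a * b * e)); last by ring.
  by rewrite ler_wpM2r// !mulr_ge0// ltW.
rewrite ler_pM2l// => /le_trans; apply.
by rewrite ler_wpM2r// ltW.
Qed.

Lemma ray_limit_le {R : realType} m (g : R -> 'rV[R]_m.+1) x s :
  geodesic_ray g -> lands_at g x -> 0 <= s ->
  enorm (g s - x) ^+ 2 * (1 - enorm (g 0) ^+ 2) * expR s <=
  4 * (1 - enorm (g s) ^+ 2).
Proof.
move=> gr /cvg_enormP gx s0.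
have a0 := hspace_lt1 (gr.1 _ (lexx 0)); have as0 := hspace_lt1 (gr.1 _ s0).
set B := 4 * (1 - enorm (g s) ^+ 2) / ((1 - enorm (g 0) ^+ 2) * expR s).
have B0 : 0 <= B by rewrite divr_ge0 ?mulr_ge0 ?expR_ge0// ltW.
rewrite -mulrA -ler_pdivlMr ?mulr_gt0 ?expR_gt0// -/B.
rewrite -(sqr_sqrtr B0) ler_pXn2r ?nnegrE ?enorm_ge0 ?sqrtr_ge0//.
apply/ler_addgt0Pr => e e0.
have [M [_ hM]] := gx _ e0.
pose t := Num.max (M + 1) s.
have tM : M < t by rewrite lt_max ltrDl ltr01.
have st : s <= t by rewrite le_max lexx orbT.
apply: le_trans (edist_trans (g t) _ _) _; apply: lerD; last exact/ltW/hM.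
rewrite -(@ler_pXn2r _ 2)// ?nnegrE ?enorm_ge0 ?sqrtr_ge0// (sqr_sqrtr B0).
rewrite /B ler_pdivlMr ?mulr_gt0 ?expR_gt0// mulrA.
exact: ray_chord_le.
Qed.

(** A ray stays in a cone at its endpoint.  In the limit [t -> oo] the chord
    formula bounds [enorm (g s - x) ^+ 2] by a multiple of
    [expR (- s) * (1 - enorm (g s) ^+ 2)], and with the starting point it bounds
    [expR (- s)] by a multiple of [1 - enorm (g s) ^+ 2] as soon as [g s] is
    away from [g 0]. *)
Lemma ray_cone {R : realType} m (g : R -> 'rV[R]_m.+1) x :
  geodesic_ray g -> lands_at g x -> enorm x = 1 ->
  exists2 C : R, 0 < C &
    forall s, 0 <= s -> enorm (g s - x) <= C * (1 - enorm (g s) ^+ 2).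
Proof.
move=> gr gx x1; have a0 := hspace_lt1 (gr.1 _ (lexx 0)).
have g01 : enorm (g 0) < 1 := gr.1 _ (lexx 0).
pose d := enorm (x - g 0).
have d0 : 0 < d.
  by have := ler_enorm_dist x (g 0); rewrite -/d x1; lra.
pose a := 1 - enorm (g 0) ^+ 2; rewrite -/a in a0.
(* the first term serves when [g s] is near [x], the second one otherwise *)
exists (2 / d + 32 / (a * d ^+ 2)) => [|s s0].
  by rewrite addr_gt0// divr_gt0// mulr_gt0// exprn_gt0.
have as0 := hspace_lt1 (gr.1 _ s0).
have lim := ray_limit_le gr gx s0; rewrite -/a in lim.
have es : 1 <= expR s by rewrite -expR0 ler_expR.
have u0 := enorm_ge0 (g s - x).
rewrite mulrDl; have [far|near] := ltP (d / 2) (enorm (g s - x)).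
  have h2 : enorm (g s - x) <= 2.
    by have := enormD (g s) (- x); rewrite enormN x1; have /= := gr.1 _ s0; rewrite /hspace/=; lra.
  apply: (@le_trans _ _ (32 / (a * d ^+ 2) * (1 - enorm (g s) ^+ 2))); last first.
    by rewrite lerDr mulr_ge0// ltW// divr_gt0.
  rewrite mulrAC ler_pdivlMr ?mulr_gt0// ?exprn_gt0//.
  have h3 : (d / 2) ^+ 2 <= enorm (g s - x) ^+ 2.
    by rewrite ler_pXn2r ?nnegrE ?enorm_ge0// ?ltW// divr_gt0.
  have h4 : (d / 2) ^+ 2 * a <= enorm (g s - x) ^+ 2 * a * expR s.
    apply: (@le_trans _ _ (enorm (g s - x) ^+ 2 * a)); first by rewrite ler_wpM2r// ltW.
    by rewrite ler_peMr// mulr_ge0 ?sqr_ge0// ltW.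
  apply: (@le_trans _ _ (2 * (a * d ^+ 2))); last by lra.
  by rewrite ler_wpM2r// mulr_ge0 ?sqr_ge0// ltW.
apply: (@le_trans _ _ (2 / d * (1 - enorm (g s) ^+ 2))); last first.
  by rewrite lerDl mulr_ge0 ?ltW// divr_gt0// mulr_gt0// exprn_gt0.
have v0 : d / 2 <= enorm (g 0 - g s).
  have := edist_trans (g s) x (g 0); rewrite -/d (edistC x) (edistC (g s) (g 0)); lra.
have ch := ray_chord gr (lexx 0) s0; rewrite -/a expR0 invr1 mulr1 mul1r in ch.
rewrite mulrAC ler_pdivlMr//.
suff : enorm (g s - x) * enorm (g 0 - g s) <= 1 - enorm (g s) ^+ 2 by nra.
rewrite -(@ler_pXn2r _ 2) ?nnegrE ?mulr_ge0 ?enorm_ge0// ?(ltW as0)//.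
rewrite exprMn -(ler_pM2l a0) -(@ler_pM2l _ 4)//.
rewrite (_ : 4 * _ = (enorm (g s - x) ^+ 2 * a) * (4 * enorm (g 0 - g s) ^+ 2)); last by ring.
rewrite ch.
move: as0 lim es; set b := 1 - _; set e := expR s; set u := _ ^+ 2 * a => b0 lim es.
have ei : e^-1 <= 1 by rewrite invf_le1//; lra.
apply: (@le_trans _ _ (u * (e * (a * b)))).
  rewrite ler_wpM2l ?mulr_ge0 ?sqr_ge0// ?(ltW a0)// ler_wpM2r ?mulr_ge0 ?ltW//; lra.
rewrite [leLHS](_ : _ = (u * e) * (a * b)); last by ring.
rewrite [leRHS](_ : _ = (4 * b) * (a * b)); last by ring.
by apply: ler_wpM2r lim; rewrite ltW// mulr_gt0.
Qed.

Lemma hdist_le_chord {R : realType} m (z w : 'rV[R]_m.+1) M :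
  hspace R m z -> hspace R m w -> hdist z w <= M ->
  enorm (z - w) ^+ 2 <= expR M * ((1 - enorm z ^+ 2) * (1 - enorm w ^+ 2)).
Proof.
move=> hz hw zw; have t1 := hdist_arg_ge1 hz hw.
rewrite -ler_pdivrMr ?mulr_gt0 ?hspace_lt1//.
apply: (@le_trans _ _ (expR (hdist z w))); last by rewrite ler_expR.
rewrite expR_arcosh//; move: t1; rewrite -mulrA; set r := _ / _ => t1.
by have := sqrtr_ge0 ((1 + 2 * r) ^+ 2 - 1); lra.
Qed.

(** With [a] and [b] for the two values of [1 - enorm _ ^+ 2], a bound on the
    hyperbolic distance bounds [enorm (z - w) ^+ 2] by a multiple of [a * b],
    while [`|a - b|] is at most [2 * enorm (z - w)]. *)
Lemma hdist_le_comparable {R : realType} m (z w : 'rV[R]_m.+1) M :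
  hspace R m z -> hspace R m w -> hdist z w <= M ->
  1 - enorm w ^+ 2 <= (4 * expR M + 2) * (1 - enorm z ^+ 2) /\
  enorm (z - w) <= (4 * expR M + 2) * (1 - enorm z ^+ 2).
Proof.
move=> hz hw /(hdist_le_chord hz hw).
move: (expR M) (expR_gt0 M) => K K0.
have [b0 a0] := (hspace_lt1 hz, hspace_lt1 hw).
have ab : `|(1 - enorm w ^+ 2) - (1 - enorm z ^+ 2)| <= 2 * enorm (z - w).
  rewrite (_ : _ - _ = (enorm z - enorm w) * (enorm z + enorm w)); last by ring.
  rewrite normrM mulrC ler_pM//.
    have [z0 w0] := (enorm_ge0 z, enorm_ge0 w).
    by rewrite ger0_norm ?addr_ge0//; move: hz hw; rewrite /hspace/=; lra.
  have := ler_enorm_dist z w; have := ler_enorm_dist w z; rewrite (edistC w).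
  by rewrite ler_norml; lra.
move: ab b0 a0 (enorm_ge0 (z - w)).
set b := 1 - _; set a := 1 - _; set u := enorm _ => ab b0 a0 u0 uK.
have ab2 : (b - a) ^+ 2 <= 4 * K * (a * b).
  rewrite -(real_normK (num_real _)).
  apply: (@le_trans _ _ ((2 * u) ^+ 2)); first by rewrite ler_pXn2r ?nnegrE ?mulr_ge0.
  by rewrite exprMn; nra.
have aK : b <= (4 * K + 2) * a by nra.
split=> //; rewrite -(@ler_pXn2r _ 2) ?nnegrE ?mulr_ge0//; nra.
Qed.

(** Nontangential accumulation: this turns out to be conical convergence without
    reference to rays and hyperbolic distances. *)
Definition conical_point {R : realType} m (E : set 'rV[R]_m.+1) (x : 'rV[R]_m.+1) :=
  exists C : R, forall e : R, 0 < e ->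
    exists z, [/\ E z, enorm (z - x) < e & enorm (z - x) <= C * (1 - enorm z)].

Lemma conical_limit_conical_point {R : realType} m (E : set 'rV[R]_m.+1) x :
  E `<=` hspace R m -> conical_limit_set E x -> conical_point E x.
Proof.
move=> EH [x1 [z Ez [zx [g [gr gx [M hM]]]]]].
have [C C0 gC] := ray_cone gr gx x1.
pose K : R := 4 * expR (M + 1) + 2.
have K0 : 0 < K by rewrite /K; have := expR_gt0 (M + 1); lra.
exists (2 * (K + C * K)) => e e0.
have [N _ hN] := (iffLR (cvg_enormP _ _)) zx e e0.
exists (z N); split=> //; first by apply: hN => /=.
have hz := EH _ (Ez N).
have [_ [_ [t t0 <-] <-] zt] : exists2 h, [set hdist (z N) w | w in ray_set g] h & h < M + 1.
  apply: inf_lt; first by exists (hdist (z N) (g 0)), (g 0) => //; exists 0 => //=.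
  by have := hM N; rewrite /hdist_set; lra.
have [h1 h2] := hdist_le_comparable hz (gr.1 _ t0) (ltW zt).
have h3 := gC _ t0.
have z0 := enorm_ge0 (z N); have b0 := hspace_lt1 hz.
have b1 : 1 - enorm (z N) ^+ 2 <= 2 * (1 - enorm (z N)).
  by move: hz; rewrite /hspace/=; nra.
apply: le_trans (edist_trans (g t) _ _) _.
apply: (@le_trans _ _ ((K + C * K) * (1 - enorm (z N) ^+ 2))); last first.
  by rewrite (mulrC 2) -mulrA ler_wpM2l// ltW// addr_gt0// mulr_gt0.
rewrite mulrDl lerD// (le_trans h3)// -mulrA ler_wpM2l// ltW//.
Qed.

(** The coefficient is the hyperbolic tangent of [t / 2]. *)
Definition diameter_ray {R : realType} m (x : 'rV[R]_m.+1) (t : R) :=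
  ((expR t - 1) / (expR t + 1)) *: x.

Lemma diameter_ray_geodesic {R : realType} m (x : 'rV[R]_m.+1) :
  enorm x = 1 -> geodesic_ray (diameter_ray x).
Proof.
move=> x1; split=> [t t0|s t s0 t0]; rewrite /diameter_ray.
  have e1 : 1 <= expR t by rewrite -expR0 ler_expR.
  rewrite /hspace/= enormZ x1 mulr1 ger0_norm; last by rewrite divr_ge0//; lra.
  by rewrite ltr_pdivrMr; lra.
rewrite -[s in RHS]expRK -[t in RHS]expRK -arcosh_cosh ?expR_gt0//.
rewrite /hdist -scalerBl !enormZ x1 !mulr1.
move: (expR_gt0 s) (expR_gt0 t); move: (expR s) (expR t) => a b a0 b0.
rewrite !real_normK ?num_real//; congr arcosh.
have ab : 0 < a * b by rewrite mulr_gt0.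
by field; do ?[apply/andP; split]; apply: lt0r_neq0; nra.
Qed.

Lemma diameter_ray_lands {R : realType} m (x : 'rV[R]_m.+1) :
  enorm x = 1 -> lands_at (diameter_ray x) x.
Proof.
move=> x1; apply/cvg_enormP => e e0; exists (2 / e); split; first exact: num_real.
move=> t te; rewrite /diameter_ray -{2}(scale1r x) -scalerBl enormZ x1 mulr1.
have et := expR_ge1Dx t.
have t0 : 0 < t by apply: lt_trans te; rewrite divr_gt0.
rewrite (_ : _ - 1 = - (2 / (expR t + 1))); last by field; rewrite gt_eqF//; lra.
rewrite normrN gtr0_norm; last by rewrite divr_gt0//; lra.
by rewrite ltr_pdivrMr; [move: te; rewrite ltr_pdivrMr//|]; nra.
Qed.

Lemma conical_point_conical_limit {R : realType} m (E : set 'rV[R]_m.+1) x :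
  E `<=` hspace R m -> enorm x = 1 -> conical_point E x -> conical_limit_set E x.
Proof.
move=> EH x1 [C hC]; split=> //.
have /choice[z hz] : forall n : nat, exists z, [/\ E z, enorm (z - x) < n.+1%:R^-1 &
    enorm (z - x) <= C * (1 - enorm z)] by move=> n; exact: hC.
exists z => [n|]; first by case: (hz n).
split.
  apply/cvg_enormP => e e0; near=> n; have [_ + _] := hz n; move=> /lt_trans; apply.
  near: n; exact: near_infty_natSinv_lt (PosNum e0).
exists (diameter_ray x); split; [exact: diameter_ray_geodesic|exact: diameter_ray_lands|].
exists (arcosh (1 + 2 * (C + 1) ^+ 2)) => n.
have [/EH zH _ zC] := hz n; move: (z n) zH zC => y yH yC.
have y0 := enorm_ge0 y; have y1 : enorm y < 1 := yH.
have wray : ray_set (diameter_ray x) (enorm y *: x).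
  exists (ln ((1 + enorm y) / (1 - enorm y))) => /=.
    by apply: ln_ge0; rewrite ler_pdivlMr; lra.
  rewrite /diameter_ray lnK; last by rewrite posrE divr_gt0//; lra.
  by congr (_ *: _); field; apply/andP; split; apply: lt0r_neq0; lra.
have wH : hspace R m (enorm y *: x) by rewrite /hspace/= enormZ x1 mulr1 ger0_norm.
apply: (@le_trans _ _ (hdist y (enorm y *: x))).
  apply: ge_inf; last by exists (enorm y *: x).
  exists 0 => _ [_ [t t0 <-] <-]; apply/arcosh_ge0/hdist_arg_ge1 => //.
  exact: (diameter_ray_geodesic x1).1.
apply: arcosh_le; first exact: hdist_arg_ge1.
rewrite lerD2l -mulrA ler_pM2l// enormZ x1 mulr1 ger0_norm//.
have d : enorm (y - enorm y *: x) <= (C + 1) * (1 - enorm y).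
  apply: le_trans (edist_trans x _ _) _; rewrite mulrDl mul1r lerD//.
  by rewrite -{1}(scale1r x) -scalerBl enormZ x1 mulr1 ger0_norm//; lra.
have b0 := hspace_lt1 yH.
rewrite ler_pdivrMr ?mulr_gt0//.
apply: (@le_trans _ _ (((C + 1) * (1 - enorm y)) ^+ 2)).
  by rewrite ler_pXn2r ?nnegrE ?enorm_ge0// (le_trans _ d)// enorm_ge0.
rewrite exprMn ler_wpM2l ?sqr_ge0// -expr2 ler_pXn2r// ?nnegrE; nra.
Unshelve. all: by end_near. Qed.

(** In the direction from rays to cones this is [ray_cone] combined with
    [hdist_le_comparable]; conversely the diameter ending at [x] serves as ray,
    and a point [z] of the cone is compared with [enorm z *: x]. *)
Lemma conical_limitP {R : realType} m (E : set 'rV[R]_m.+1) :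
  E `<=` hspace R m ->
  conical_limit_set E = [set x | enorm x = 1 /\ conical_point E x].
Proof.
move=> EH; apply/seteqP; split=> x.
  by move=> xE; split; [case: xE|exact: conical_limit_conical_point].
by move=> [x1 /conical_point_conical_limit]; exact.
Qed.

(** * Realizing sets as conical limit sets *)

Lemma Gdelta_inP {T : topologicalType} (X A : set T) :
  Gdelta_in X A <->
  exists U : nat -> set T, [/\ forall k, open (U k),
    forall k l, (k <= l)%N -> U l `<=` U k & A = X `&` \bigcap_k U k].
Proof.
split=> [[AX [F oF AF]]|[U [oU _ ->]]]; last first.
  split; first exact: subIsetl.
  exists (fun k => U k `&` X) => [k|].
    by apply/open_subspaceP; exists (U k) => //; rewrite -setIA setIid.
  apply/seteqP; split=> x; first by move=> [Xx Ux] k _; split=> //; exact: Ux.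
  by move=> UX; split=> [|k _]; [case: (UX 0%N I)|case: (UX k I)].
have /choice[V hV] : forall k, exists V, open (V : set T) /\ V `&` X = F k `&` X.
  by move=> k; have /open_subspaceP[V oV VX] := oF k; exists V.
have VFX k x : X x -> V k x <-> F k x.
  move=> Xx; have [_ /seteqP[VF FV]] := hV k.
  by split=> h; [have [] := VF x (conj h Xx)|have [] := FV x (conj h Xx)].
exists (fun k => \bigcap_(i in `I_k.+1) V i); split.
- move=> k; rewrite bigcap_mkord; elim/big_rec : _ => [|i W _ oW]; first exact: openT.
  by apply: openI => //; case: (hV i).
- by move=> k l kl x Vx i /= ik; apply: Vx => /=; exact: leq_trans ik _.
- apply/seteqP; split=> x.
    move=> Ax; have Xx := AX _ Ax; split=> // k _ i _.
    by apply/VFX => //; move: Ax; rewrite AF; apply.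
  move=> [Xx Vx]; rewrite AF => i _; apply/VFX => //.
  exact: (Vx i I i (ltnSn i)).
Qed.

Lemma common_pos_bound {R : realType} (P : nat -> R -> Prop) (n : nat) :
  (forall k e e', 0 < e' -> e' <= e -> P k e -> P k e') ->
  (forall k, exists2 e, 0 < e & P k e) ->
  exists2 e, 0 < e & forall k, (k < n)%N -> P k e.
Proof.
move=> Pmono Pex; elim: n => [|n [e e0 he]]; first by exists 1.
have [e1 e10 h1] := Pex n; exists (Num.min e e1) => [|k]; first by rewrite lt_min e0.
rewrite ltnS leq_eqVlt => /orP[/eqP ->|/he].
  by apply: Pmono h1; rewrite ?lt_min ?e0// ge_min lexx orbT.
by apply: Pmono; rewrite ?lt_min ?e0// ge_min lexx.
Qed.

(** A radius that cannot be doubled replaces the distance from [y] to the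
    complement of [V]: it exists at every point of [V], and near a given point
    of [V] such radii are bounded from below. *)
Definition adapted_radius {R : realType} n (V : set 'rV[R]_n) (eta : R)
    (y : 'rV[R]_n) (d : R) :=
  [/\ 0 < d, d <= eta, forall v, enorm (v - y) < d -> V v &
      ~ (2 * d <= eta /\ forall v, enorm (v - y) < 2 * d -> V v)].

Lemma adapted_radius_ex {R : realType} n (V : set 'rV[R]_n) (eta : R) y :
  open V -> V y -> 0 < eta -> exists d, adapted_radius V eta y d.
Proof.
move=> /open_enormP oV /oV[e e0 eV] eta0.
pose P i := `[< forall v, enorm (v - y) < eta / 2 ^+ i -> V v >].
have exP : exists i, P i.
  have [N hN] : exists N, eta / e < 2 ^+ N.
    exists (Num.truncn (eta / e)).+1; apply: lt_trans (truncnS_gt _) _.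
    by rewrite -natrX ltr_nat ltn_expl.
  exists N; apply/asboolP => v vy; apply: eV; apply: lt_trans vy _.
  by rewrite ltr_pdivrMr ?exprn_gt0// mulrC -ltr_pdivrMr.
case: (ex_minnP exP) => i /asboolP iV imin; exists (eta / 2 ^+ i).
split=> //; first by rewrite divr_gt0// exprn_gt0.
  by rewrite ler_pdivrMr ?exprn_gt0// ler_peMr ?(ltW eta0)// exprn_ege1// ler1n.
case: i iV imin => [|i] iV imin [h1 h2].
  by move: h1; rewrite expr0 divr1; lra.
suff /imin : P i by rewrite ltnn.
apply/asboolP => v vy; apply: h2.
by rewrite (_ : 2 * _ = eta / 2 ^+ i)// exprS; field; rewrite gt_eqF// exprn_gt0.
Qed.

Lemma adapted_radius_lower {R : realType} n (V : set 'rV[R]_n) (eta : R) x :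
  open V -> V x -> 0 < eta -> exists2 e, 0 < e &
  forall y d, adapted_radius V eta y d -> enorm (x - y) < d -> e <= d.
Proof.
move=> /open_enormP oV /oV[e e0 eV] eta0.
exists (Num.min (eta / 2) (e / 3)); first by rewrite lt_min !divr_gt0.
move=> y d [d0 _ _ nd] xy; rewrite leNgt lt_min; apply/negP => /andP[d1 d2].
apply: nd; split=> [|v vy]; first lra.
by apply: eV; have := edist_trans y v x; rewrite (edistC y x); lra.
Qed.

(** For each [j] and [k], the points of the set with index [j] are approached
    from points [z] at height about [r] under the sphere whose distance to [Y]
    is at least [j.+1 * r]; a cone of given aperture at a point of [Y] then only
    contains such points for finitely many [j].  The height [r] is the square of
    an adapted radius [d] for [U j k], so that it is negligible with respect to
    [d].  Hence if a cone at [x] contains such a point [z] close to [x], then [x]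
    lies in [U j k].  Near [x] the adapted radii for finitely many [U j k]
    are bounded from below, so that points [z] tending to [x] have bounded [j]
    and unbounded [k]. *)
Lemma conical_limit_realization {R : realType} m (Y : set 'rV[R]_m.+1)
    (J : set nat) (U : nat -> nat -> set 'rV[R]_m.+1) :
  closed Y -> Y `<=` ideal_sphere R m ->
  (forall j k, open (U j k)) ->
  (forall j k l, (k <= l)%N -> U j l `<=` U j k) ->
  (forall j, J j -> exists L r0 : R, [/\ 0 < L, 0 < r0 & forall y r,
     (Y `&` \bigcap_k U j k) y -> 0 < r -> r <= r0 ->
     exists z, [/\ enorm (z - y) <= L * r, r / 2 <= 1 - enorm z, 1 - enorm z <= r &
       forall x, Y x -> j.+1%:R * r <= enorm (z - x)]]) ->
  CL R m (\bigcup_(j in J) (Y `&` \bigcap_k U j k)).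
Proof.
move=> clY YS oU Umono hz.
have /choice[Lr hLr] : forall j, exists Lr : R * R, [/\ 0 < Lr.1, 0 < Lr.2 & J j ->
    forall y r, (Y `&` \bigcap_k U j k) y -> 0 < r -> r <= Lr.2 ->
     exists z, [/\ enorm (z - y) <= Lr.1 * r, r / 2 <= 1 - enorm z, 1 - enorm z <= r &
       forall x, Y x -> j.+1%:R * r <= enorm (z - x)]].
  move=> j; have [/hz[L [r0 [L0 r00 h]]]|nJ] := pselect (J j).
    by exists (L, r0).
  by exists (1, 1).
pose eta j k : R := Num.min (Num.min 1 (Lr j).2) (Num.min ((Lr j).1^-1) (k.+1%:R^-1)).
have eta0 j k : 0 < eta j k.
  have [? ? _] := hLr j; rewrite !lt_min ltr01 invr_gt0.
  by apply/and3P; split=> //; rewrite invr_gt0.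
pose data j k y d := [/\ J j, (Y `&` \bigcap_k U j k) y & adapted_radius (U j k) (eta j k) y d].
have dataP j k y d : data j k y d ->
    [/\ 0 < d, d <= 1, d ^+ 2 <= (Lr j).2, (Lr j).1 * d ^+ 2 <= d & d <= k.+1%:R^-1].
  move=> [Jj _ [d0]]; rewrite !le_min -!andbA => /and4P[d1 dr dL dk] _ _.
  have [L0 r0 _] := hLr j.
  split=> //; first by apply: le_trans dr; rewrite expr2 ger_pMl.
  have : (Lr j).1 * d <= 1 by rewrite mulrC -ler_pdivlMr// div1r.
  by move=> h; rewrite expr2 mulrA ger_pMl.
pose E := [set z : 'rV[R]_m.+1 | exists j k y d, [/\ data j k y d,
  enorm (z - y) <= (Lr j).1 * d ^+ 2, d ^+ 2 / 2 <= 1 - enorm z, 1 - enorm z <= d ^+ 2 &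
  forall x, Y x -> j.+1%:R * d ^+ 2 <= enorm (z - x)]].
have EH : E `<=` hspace R m.
  move=> z [j [k [y [d [/dataP[d0 _ _ _ _] _ h _ _]]]]].
  by rewrite /hspace/=; have := exprn_gt0 2 d0; lra.
exists E => //; rewrite conical_limitP//; apply/seteqP; split=> x; last first.
  move=> [j Jj Ax]; split; first exact: YS Ax.1.
  exists (2 * (Lr j).1) => e e0.
  have [k hk] : exists k : nat, k.+1%:R^-1 < e.
    exists (Num.truncn e^-1); rewrite invf_plt ?posrE//; exact: truncnS_gt.
  have [d hd] := adapted_radius_ex (oU j k) (Ax.2 k I) (eta0 j k).
  have D : data j k x d by [].
  have [d0 d1 dr dL dk] := dataP _ _ _ _ D.
  have [L0 _ /(_ Jj x (d ^+ 2) Ax (exprn_gt0 2 d0) dr)[z [zx z1 z2 zY]]] := hLr j.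
  exists z; split; first by exists j, k, x, d.
    by apply: le_lt_trans hk; apply: le_trans dk; apply: le_trans dL.
  apply: le_trans zx _; rewrite (mulrC 2) -mulrA ler_wpM2l//; lra.
move=> [x1 [C hC]].
have height z : 1 - enorm z <= enorm (z - x).
  by have := ler_enorm_dist x z; rewrite x1 edistC.
have Yx : Y x.
  apply: contrapT => nYx.
  have /open_enormP oY : open (~` Y) by exact: closed_openC.
  have [e e0 eY] := oY x nYx.
  have e20 : 0 < e ^+ 2 by rewrite exprn_gt0.
  have [|z [[j [k [y [d [D zy z1 _ _]]]]] zx _]] := hC (Num.min (e / 2) (e ^+ 2 / 8)).
    by rewrite lt_min !divr_gt0.
  have [d0 _ _ dL _] := dataP _ _ _ _ D.
  have [_ [Yy _] _] := D.
  move: zx; rewrite lt_min => /andP[zx1 zx2].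
  apply: (eY y) => //; apply: le_lt_trans (edist_trans z _ _) _.
  have de : d < e / 2.
    rewrite -(@ltr_pXn2r _ 2)// ?nnegrE ?divr_ge0 ?ltW// exprMn.
    by have := height z; lra.
  by rewrite edistC; lra.
apply: contrapT => nA.
have [e e0 he] : exists2 e : R, 0 < e & forall j, (j < (Num.truncn C).+1)%N ->
    e * (C + (Lr j).1) <= 1 /\
    forall k y d, data j k y d -> enorm (x - y) < d -> e <= d.
  apply: (common_pos_bound (P := fun j e => e * (C + (Lr j).1) <= 1 /\
    forall k y d, data j k y d -> enorm (x - y) < d -> e <= d)).
    move=> j e e' e'0 e'e [h1 h2]; split=> [|k y d D xy]; last first.
      by apply: le_trans e'e _; exact: h2 D xy.
    have [/ltW L0|L0] := ltP 0 (C + (Lr j).1).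
      by apply: le_trans h1; rewrite ler_wpM2r.
    by apply: le_trans ler01; rewrite pmulr_rle0.
  move=> j; have [L0 _ _] := hLr j.
  suff [e e0 he] : exists2 e, 0 < e & forall k y d, data j k y d -> enorm (x - y) < d -> e <= d.
    have c0 : 0 < `|C| + (Lr j).1 by rewrite ltr_wpDl.
    exists (Num.min e ((`|C| + (Lr j).1)^-1)); first by rewrite lt_min e0 invr_gt0.
    split=> [|k y d D xy]; last by apply: le_trans (he _ _ _ D xy); rewrite ge_min lexx.
    apply: (@le_trans _ _ (Num.min e ((`|C| + (Lr j).1)^-1) * (`|C| + (Lr j).1))).
      by rewrite ler_wpM2l ?lerD2r ?ler_norm// ltW// lt_min e0 invr_gt0.
    apply: (@le_trans _ _ ((`|C| + (Lr j).1)^-1 * (`|C| + (Lr j).1))).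
      by rewrite ler_wpM2r ?(ltW c0)// ge_min lexx orbT.
    by rewrite mulVf// gt_eqF.
  have [Jj|nJ] := pselect (J j); last by exists 1 => // k y d [].
  have [K xK] : exists K, ~ U j K x.
    apply: contrapT => nU; apply: nA; exists j => //; split=> // k _.
    by apply: contrapT => h; apply: nU; exists k.
  have [||e e0 he] := @common_pos_bound R
    (fun k e => forall y d, data j k y d -> enorm (x - y) < d -> e <= d) K.
  - by move=> k e e' _ e'e h y d D xy; apply: le_trans e'e (h _ _ D xy).
  - move=> k; have [Ux|nU] := pselect (U j k x); last first.
      by exists 1 => // y d [_ _ [_ _ h _]] /h.
    have [e e0 he] := adapted_radius_lower (oU j k) Ux (eta0 j k).
    by exists e => // y d [_ _]; exact: he.
  - exists e => // k y d D xy; have [kK|Kk] := ltnP k K; first exact: he D xy.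
    by case: xK; apply: (Umono _ _ _ Kk); case: D => _ _ [_ _ h _]; exact: h.
have [|z [[j [k [y [d [D zy z1 z2 zY]]]]] zx zC]] := hC (e ^+ 2 / 2).
  by rewrite divr_gt0// exprn_gt0.
have [d0 _ _ _ _] := dataP _ _ _ _ D.
have d20 : 0 < d ^+ 2 by rewrite exprn_gt0.
have jC : j.+1%:R <= C.
  rewrite -(ler_pM2r d20); apply: le_trans (zY _ Yx) _; apply: (le_trans zC).
  rewrite ler_wpM2l//.
  have z10 : 0 < 1 - enorm z by lra.
  by rewrite -(pmulr_lge0 _ z10); apply: le_trans zC; exact: enorm_ge0.
have jn : (j < (Num.truncn C).+1)%N.
  rewrite -(ltr_nat R); apply: lt_trans (truncnS_gt C); apply: lt_le_trans jC.
  by rewrite ltr_nat.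
have [eC hj] := he _ jn.
have de : d < e.
  rewrite -(@ltr_pXn2r _ 2)// ?nnegrE ?ltW//.
  by have := height z; lra.
suff : enorm (x - y) < d by move=> /(hj _ _ _ D); rewrite leNgt de.
have [L0 _ _] := hLr j.
have C0 : 0 < C by apply: lt_le_trans jC.
apply: le_lt_trans (edist_trans z _ _) _; rewrite edistC.
apply: (@le_lt_trans _ _ (d * (d * (C + (Lr j).1)))).
  have : C * (1 - enorm z) <= C * d ^+ 2 by rewrite ler_wpM2l// ltW.
  rewrite (_ : d * _ = C * d ^+ 2 + (Lr j).1 * d ^+ 2); last by ring.
  lra.
rewrite gtr_pMr//; apply: lt_le_trans eC.
by rewrite ltr_pM2r// addr_gt0.
Qed.

(** * Conical limit sets and Borel classes *)

Lemma lipschitz_preimage_closed {R : realType} n (phi : 'rV[R]_n -> R) (K : R)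
    (B : set R) :
  (forall u v, `|phi u - phi v| <= K * enorm (u - v)) -> closed B ->
  closed (phi @^-1` B).
Proof.
move=> lip; apply: closed_comp => // x _ V /nbhs_ballP[e /= e0 eV].
apply/nbhs_enormP; exists (e / (`|K| + 1)).
  by rewrite divr_gt0// ltr_wpDl.
move=> y; rewrite ltr_pdivlMr ?ltr_wpDl// => h.
apply: eV; rewrite /ball/=; apply: le_lt_trans (lip _ _) _.
apply: le_lt_trans h; rewrite edistC mulrC.
by rewrite ler_wpM2l ?enorm_ge0//; have := ler_norm K; lra.
Qed.

Lemma enorm_lipschitz {R : realType} n (u v : 'rV[R]_n) :
  `|enorm u - enorm v| <= 1 * enorm (u - v).
Proof.
rewrite mul1r; have := ler_enorm_dist u v; have := ler_enorm_dist v u.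
by rewrite (edistC v) ler_norml; lra.
Qed.

Lemma edot_lipschitz {R : realType} n (b u v : 'rV[R]_n) :
  `|edot u b - edot v b| <= enorm b * enorm (u - v).
Proof. by rewrite -edotNl -edotDl mulrC ler_edot. Qed.

Lemma ideal_sphere_closed {R : realType} m : closed (ideal_sphere R m).
Proof.
exact: (lipschitz_preimage_closed (phi := @enorm R m.+1) (@enorm_lipschitz R _) (@closed_eq R 1)).
Qed.

(** For a fixed aperture the condition of having points of [E] in the cone and
    close to [x] is open in [x]; the aperture may be taken among the positive
    integers. *)
Lemma CL_sub_Gdelta_sigma {R : realType} m :
  CL R m `<=` Gdelta_sigma_in (ideal_sphere R m).
Proof.
move=> _ [E EH <-]; rewrite conical_limitP//.
pose U i k := [set x : 'rV[R]_m.+1 | exists z,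
  [/\ E z, enorm (z - x) < k.+1%:R^-1 & enorm (z - x) < i.+1%:R * (1 - enorm z)]].
exists (fun i => ideal_sphere R m `&` \bigcap_k U i k).
  move=> i; apply/Gdelta_inP; exists (U i); split=> //.
    move=> k; apply/open_enormP => x [z [Ez z1 z2]].
    exists (Num.min (k.+1%:R^-1 - enorm (z - x)) (i.+1%:R * (1 - enorm z) - enorm (z - x))).
      by rewrite lt_min !subr_gt0 z1.
    move=> y; rewrite lt_min => /andP[y1 y2]; exists z.
    by split=> //; apply: le_lt_trans (edist_trans x _ _) _; rewrite (edistC x) -ltrBrDl.
  move=> k l kl x [z [Ez z1 z2]]; exists z; split=> //; apply: lt_le_trans z1 _.
  by rewrite lef_pV2 ?posrE ?ler_nat.
apply/seteqP; split=> x.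
  move=> [x1 [C hC]]; exists (Num.truncn C) => //; split=> // k _.
  have [|z [Ez z1 z2]] := hC k.+1%:R^-1; first by rewrite invr_gt0.
  exists z; split=> //; apply: le_lt_trans z2 _.
  by rewrite ltr_pM2r ?truncnS_gt// subr_gt0; exact: EH.
move=> [i _ [x1 Ux]]; split=> //; exists i.+1%:R => e e0.
have [k hk] : exists k : nat, k.+1%:R^-1 < e.
  exists (Num.truncn e^-1); rewrite invf_plt ?posrE//; exact: truncnS_gt.
have [z [Ez z1 z2]] := Ux k I; exists z; split=> //; first exact: lt_trans z1 hk.
exact: ltW.
Qed.

(** Radial points [(1 - r) *: y] are at distance at least [r] from the sphere, so
    that a single family realizes a G-delta set. *)
Lemma Gdelta_sub_CL {R : realType} m : Gdelta_in (ideal_sphere R m) `<=` CL R m.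
Proof.
move=> A /Gdelta_inP[U [oU Umono ->]].
rewrite (_ : _ `&` _ = \bigcup_(j in [set 0%N]) (ideal_sphere R m `&` \bigcap_k U k)); last first.
  by rewrite bigcup_set1.
apply: (@conical_limit_realization _ _ (ideal_sphere R m) [set 0%N] (fun=> U)) => //.
  exact: ideal_sphere_closed.
move=> _ ->; exists 1, 1; split=> // y r [y1 _] r0 r1.
have yr : enorm ((1 - r) *: y) = 1 - r.
  by rewrite enormZ y1 mulr1 ger0_norm; lra.
exists ((1 - r) *: y); rewrite yr; split; [|lra|lra|].
  by rewrite -{2}(scale1r y) -scalerBl enormZ y1 mulr1 addrAC subrr add0r normrN mul1r gtr0_norm.
by move=> x x1; have := ler_enorm_dist x ((1 - r) *: y); rewrite yr x1 edistC; lra.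
Qed.

(** Moving [y] towards the interior by [r] and along the sphere, orthogonally to
    the slice, by a fixed multiple of [r]: the second displacement changes the
    norm to second order only. *)
Lemma displaced_point {R : realType} m (b : 'rV[R]_m.+1) (c D : R) :
  enorm b = 1 -> c ^+ 2 < 1 -> 0 <= D ->
  exists L r0 : R, [/\ 0 < L, 0 < r0 & forall y d r,
    enorm y = 1 -> edot y b = c -> 0 < r -> r <= r0 -> `|d| <= D * r ->
    exists z, [/\ edot z b = c + d, enorm (z - y) <= L * r, r / 2 <= 1 - enorm z &
      1 - enorm z <= r]].
Proof.
move=> b1 c1 D0; pose kap := 1 - c ^+ 2.
have k0 : 0 < kap by rewrite subr_gt0.
have k1 : kap <= 1 by rewrite gerBl sqr_ge0.
have D1 : 0 < (D + 1) ^+ 2 by rewrite exprn_gt0//; lra.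
exists (1 + (D + 1) / kap), (kap / ((D + 1) ^+ 2 + kap)); split.
- by rewrite addr_gt0// divr_gt0//; lra.
- by rewrite divr_gt0//; lra.
move=> y d r y1 yb r0 rr0 dD.
have rk : r * ((D + 1) ^+ 2 + kap) <= kap by rewrite -ler_pdivlMr//; lra.
have r1 : r <= 1 by nra.
pose t := (d + r * c) / kap; pose z := (1 - r) *: y + t *: (b - c *: y).
have bb : edot b b = 1 by rewrite -enorm_sqr b1 expr1n.
have yy : edot y y = 1 by rewrite -enorm_sqr y1 expr1n.
have by_ : edot b y = c by rewrite edotC.
have tk : t * kap = d + r * c by rewrite mulfVK// gt_eqF.
have c1' : `|c| <= 1 by rewrite -(@expr_le1 _ 2)// real_normK ?num_real// ltW.
have tr : `|t| * kap <= (D + 1) * r.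
  rewrite -{1}(gtr0_norm k0) -normrM tk; apply: le_trans (ler_normD _ _) _.
  by rewrite mulrDl lerD// normrM (gtr0_norm r0) mulrC ler_wpM2r// ltW.
have zb : edot z b = c + d.
  rewrite /z !edotE bb yb [LHS](_ : _ = (1 - r) * c + t * kap); last by rewrite /kap; ring.
  by rewrite tk; ring.
have zz : enorm z ^+ 2 = (1 - r) ^+ 2 + t * (t * kap).
  by rewrite enorm_sqr /z !edotE bb yy by_ yb /kap; ring.
have w1 : enorm (b - c *: y) <= 1.
  rewrite -(@expr_le1 _ 2)// ?enorm_ge0// enorm_sqr !edotE bb yy by_ yb.
  by have := sqr_ge0 c; nra.
have ttk0 : 0 <= t * (t * kap) by rewrite mulrA -expr2 mulr_ge0 ?sqr_ge0// ltW.
have ttk : t * (t * kap) <= r - r ^+ 2.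
  rewrite -(ler_pM2r k0); apply: (@le_trans _ _ ((`|t| * kap) ^+ 2)).
    by rewrite exprMn real_normK ?num_real// [leLHS](_ : _ = t ^+ 2 * kap ^+ 2)//; ring.
  apply: (@le_trans _ _ (((D + 1) * r) ^+ 2)); last by nra.
  have t0 : 0 <= `|t| * kap by rewrite mulr_ge0// ltW.
  by rewrite ler_pXn2r ?nnegrE// (le_trans t0).
have z0 := enorm_ge0 z.
have z1 : enorm z <= 1 by rewrite -(@expr_le1 _ 2)// zz; nra.
exists z; split=> //.
- rewrite (_ : z - y = - (r *: y) + t *: (b - c *: y)); last first.
    by rewrite /z scalerBl scale1r addrAC; congr (_ + _); rewrite addrAC subrr add0r.
  apply: le_trans (enormD _ _) _; rewrite enormN !enormZ y1 (gtr0_norm r0) mulr1.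
  rewrite mulrDl mul1r lerD2l; apply: (@le_trans _ _ `|t|); first by rewrite ler_piMr.
  by rewrite mulrAC ler_pdivlMr.
- by nra.
- have : (1 - r) ^+ 2 <= enorm z ^+ 2 by rewrite zz; lra.
  by rewrite ler_pXn2r ?nnegrE//; lra.
Qed.

(** * Spheres of codimension one *)

Definition plane_section {R : realType} m (b : 'rV[R]_m.+1) (c : R) :=
  ideal_sphere R m `&` [set x | edot x b = c].

Lemma involution_plane_section {R : realType} m (f : 'rV[R]_m.+1 -> 'rV[R]_m.+1)
    b c b' c' :
  (forall x, ideal_sphere R m x -> ideal_sphere R m (f x)) ->
  (forall x, ideal_sphere R m x -> f (f x) = x) ->
  (forall x, ideal_sphere R m x -> edot (f x) b = c <-> edot x b' = c') ->
  f @` plane_section b c = plane_section b' c'.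
Proof.
move=> fS ff fbc; apply/seteqP; split=> x.
  move=> [y [yS yb] <-]; split; first exact: fS.
  by apply/(fbc _ (fS _ yS)); rewrite ff.
move=> [xS /fbc xb]; exists (f x); last exact: ff.
by split; [exact: fS|exact: xb].
Qed.

Lemma hyperplane_reflection_section {R : realType} m (a : 'rV[R]_m.+1) :
  a != 0 -> (forall x, ideal_sphere R m x -> ideal_sphere R m (hyperplane_reflection a x)) /\
  forall b c, c ^+ 2 < edot b b -> exists b' c', c' ^+ 2 < edot b' b' /\
    hyperplane_reflection a @` plane_section b c = plane_section b' c'.
Proof.
rewrite -edot_eq0 => a0; set f := hyperplane_reflection a.
have fdot x y : edot (f x) (f y) = edot x y.
  by rewrite /f /hyperplane_reflection !edotE (edotC a y); field.
have ff x : f (f x) = x.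
  rewrite /f /hyperplane_reflection !edotE -addrA -opprD -scalerDl.
  by rewrite [X in X *: a](_ : _ = 0) ?scale0r ?subr0//; field.
have fS x : ideal_sphere R m x -> ideal_sphere R m (f x).
  by rewrite /ideal_sphere/= /enorm fdot.
split=> // b c bc; exists (f b), c; split; first by rewrite fdot.
by apply: involution_plane_section => // x _; rewrite -{1}(ff b) fdot.
Qed.

(** The new plane is obtained by clearing the denominator [enorm (x - a) ^+ 2],
    which is an affine function of [x] on the sphere. *)
Lemma sphere_inversion_section {R : realType} m (a : 'rV[R]_m.+1) r :
  0 < r -> enorm a ^+ 2 = 1 + r ^+ 2 ->
  (forall x, ideal_sphere R m x -> ideal_sphere R m (sphere_inversion a r x)) /\
  forall b c, c ^+ 2 < edot b b -> exists b' c', c' ^+ 2 < edot b' b' /\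
    sphere_inversion a r @` plane_section b c = plane_section b' c'.
Proof.
move=> r0; rewrite enorm_sqr => aa; set f := sphere_inversion a r.
have r20 : 0 < r ^+ 2 by rewrite exprn_gt0.
pose N (x : 'rV[R]_m.+1) := 2 + r ^+ 2 - 2 * edot x a.
have NE x : ideal_sphere R m x -> enorm (x - a) ^+ 2 = N x.
  move=> /(congr1 (fun u => u ^+ 2)); rewrite expr1n !enorm_sqr !edotE aa (edotC a x) => ->.
  by rewrite /N; ring.
have N0 x : ideal_sphere R m x -> 0 < N x.
  move=> xS; rewrite -NE// exprn_gt0// lt_neqAle enorm_ge0 eq_sym andbT enorm_eq0 subr_eq0.
  apply/eqP => xa; move: aa; rewrite -xa -enorm_sqr xS expr1n; lra.
have fE x : ideal_sphere R m x -> f x = a + (r ^+ 2 / N x) *: (x - a).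
  by move=> xS; rewrite /f /sphere_inversion NE.
have fS x : ideal_sphere R m x -> ideal_sphere R m (f x).
  move=> xS; rewrite /ideal_sphere/= -[RHS]sqrtr1 /enorm; congr Num.sqrt.
  have xx : edot x x = 1 by rewrite -enorm_sqr xS expr1n.
  have Nx := N0 _ xS; have ax : edot x a = (2 + r ^+ 2 - N x) / 2 by rewrite /N; field.
  rewrite fE// !edotE xx (edotC a x) aa ax; move: Nx; set n := N x => Nx.
  by field; rewrite gt_eqF.
have ff x : ideal_sphere R m x -> f (f x) = x.
  move=> xS; have Nx := N0 _ xS; rewrite [f (f x)]/f /sphere_inversion -/f fE// addrAC subrr add0r.
  rewrite scalerA enormZ exprMn NE// (_ : _ * _ = 1) ?scale1r ?subrKC//.
  rewrite real_normK ?num_real//; field.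
  by rewrite !gt_eqF.
split=> // b c bc; pose s := edot a b; pose e := s - c.
exists (r ^+ 2 *: b - (2 * e) *: a), (r ^+ 2 * s - e * (2 + r ^+ 2)); split.
  rewrite !edotE aa (edotC b a) -/s -subr_gt0.
  rewrite (_ : _ - _ = r ^+ 4 * (edot b b - c ^+ 2)); last by rewrite /e; ring.
  by rewrite mulr_gt0// ?exprn_gt0// subr_gt0.
apply: involution_plane_section => // x xS; have Nx := N0 _ xS.
rewrite fE// !edotE -/s.
have -> : s + r ^+ 2 / N x * (edot x b - s) =
    c + (N x * e + r ^+ 2 * (edot x b - s)) / N x.
  by rewrite /e; field; rewrite gt_eqF.
split=> [/eqP|h].
  rewrite -subr_eq0 addrAC subrr add0r mulf_eq0 invr_eq0 (gt_eqF Nx) orbF => /eqP.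
  rewrite /N; lra.
rewrite (_ : _ + _ * (_ - _) = 0) ?mul0r ?addr0//.
by rewrite /N; lra.
Qed.

Lemma moebius_plane_section {R : realType} m (f : 'rV[R]_m.+1 -> 'rV[R]_m.+1) b c :
  moebius f -> c ^+ 2 < edot b b -> exists b' c', c' ^+ 2 < edot b' b' /\
    f @` plane_section b c = plane_section b' c'.
Proof.
move=> mf bc; elim: mf => [|a g a0 _ [b1 [c1 [bc1 g1]]]|a r g r0 ar _ [b1 [c1 [bc1 g1]]]].
- by exists b, c; rewrite image_id.
- have [b2 [c2 [bc2 g2]]] := (hyperplane_reflection_section a0).2 _ _ bc1.
  by exists b2, c2; rewrite -g2 -g1 image_comp.
- have [b2 [c2 [bc2 g2]]] := (sphere_inversion_section r0 ar).2 _ _ bc1.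
  by exists b2, c2; rewrite -g2 -g1 image_comp.
Qed.

(** The condition [c ^+ 2 < edot b b] says that the plane meets the open ball;
    it is preserved because the two generators multiply
    [edot b b - c ^+ 2] by a positive factor. *)
Lemma codim1_sphere_section {R : realType} m (Y : set 'rV[R]_m.+1) :
  codim1_sphere Y -> exists b c, [/\ enorm b = 1, c ^+ 2 < 1 & Y = plane_section b c].
Proof.
move=> [a [f [a0 mf ->]]].
have [|b [c [bc ->]]] := @moebius_plane_section _ _ f a 0 mf.
  by rewrite expr0n lt_neqAle eq_sym edot_eq0 a0 edot_ge0.
have b0 : 0 < enorm b.
  rewrite lt_neqAle enorm_ge0 andbT eq_sym -sqrf_eq0 enorm_sqr gt_eqF//.
  by apply: le_lt_trans bc; exact: sqr_ge0.
exists ((enorm b)^-1 *: b), (c / enorm b); split.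
- by rewrite enormZ gtr0_norm ?invr_gt0// mulVf// gt_eqF.
- by rewrite expr_div_n enorm_sqr ltr_pdivrMr ?mul1r// -enorm_sqr exprn_gt0.
- apply/seteqP; split=> x [xS /= xb]; split=> //=.
    by rewrite edotZr xb mulrC.
  by move: xb; rewrite edotZr mulrC => /(mulIf (invr_neq0 (lt0r_neq0 b0))).
Qed.

(** There is room beside a plane section: at height [r] the family with index [j]
    is placed at distance [j.+1 * r] from the plane. *)
Lemma Gdelta_sigma_codim1_sub_CL {R : realType} m (Y : set 'rV[R]_m.+1) :
  codim1_sphere Y -> Gdelta_sigma_in Y `<=` CL R m.
Proof.
move=> /codim1_sphere_section[b [c [b1 c1 ->]]] A [F FG ->].
have /choice[U hU] : forall i, exists U : nat -> set 'rV[R]_m.+1, [/\ forall k, open (U k),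
    forall k l, (k <= l)%N -> U l `<=` U k & F i = plane_section b c `&` \bigcap_k U k].
  by move=> i; exact/Gdelta_inP.
rewrite (_ : \bigcup_i F i =
  \bigcup_(i in setT) (plane_section b c `&` \bigcap_k U i k)); last first.
  by apply: eq_bigcupr => i _; have [] := hU i.
apply: conical_limit_realization.
- apply: closedI; first exact: ideal_sphere_closed.
  exact: (lipschitz_preimage_closed (phi := fun x => edot x b) (edot_lipschitz b) (@closed_eq R c)).
- by move=> x [].
- by move=> j k; have [] := hU j.
- by move=> j; have [] := hU j.
move=> j _; have [|L [r0 [L0 r00 hL]]] := @displaced_point _ _ b c j.+1%:R b1 c1 _; first by [].
exists L, r0; split=> // y r [[yS yb] _] rpos rr0.
have [|z [zb zy z1 z2]] := hL y (j.+1%:R * r) r yS yb rpos rr0.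
  by rewrite ger0_norm// mulr_ge0// ltW.
exists z; split=> // x [_ xb].
have := edot_lipschitz b z x; rewrite b1 mul1r zb xb addrAC subrr add0r.
by rewrite ger0_norm// mulr_ge0// ltW.
Qed.

(** * Signed decimals *)

Definition sdigit {R : realType} (d : option bool) : R :=
  if d is Some b then if b then 1 else -1 else 0.

(** The digits are -1, 0 and 1 in base 10, so that two expansions that first
    differ at the k-th digit have values at distance comparable to the k-th
    power of 1/10. *)
Fixpoint sdecimal {R : realType} (s : seq (option bool)) : R :=
  if s is d :: s' then (sdigit d + sdecimal s') / 10 else 0.

Lemma sdecimal_bound {R : realType} s : `|sdecimal s : R| <= 1 / 9.
Proof.
elim: s => [|d s]; first by rewrite normr0 divr_ge0.
by rewrite /= !ler_norml; case: d => [[]|] /=; lra.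
Qed.

Lemma sdecimal_cat {R : realType} s t :
  sdecimal (s ++ t) = sdecimal s + sdecimal t / 10 ^+ size s :> R.
Proof.
elim: s => [|d s ih] /=; first by rewrite add0r expr0 divr1.
by rewrite ih exprS; field; rewrite expf_neq0.
Qed.

Lemma sdecimal_neighbour {R : realType} s k b : (size s <= k)%N ->
  exists t, sdecimal t = sdecimal s + sdigit (Some b) / 10 ^+ k.+1 :> R.
Proof.
move=> sk; exists (s ++ nseq (k - size s) None ++ [:: Some b]).
rewrite !sdecimal_cat size_nseq.
have -> n : sdecimal (nseq n None) = 0 :> R by elim: n => [|n ih] //=; rewrite ih; lra.
rewrite add0r -{2}(subnK sk) -addnS addnC exprD exprS /= addr0.
by congr (_ + _); field; rewrite !expf_neq0.
Qed.

Lemma sdecimal_hole {R : realType} s t k : (size s <= k)%N ->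
  1 / 5 / 10 ^+ k <= `|sdecimal t - sdecimal s - 2 / 5 / 10 ^+ k : R|.
Proof.
elim: k s t => [|k ih] s t sk.
  have /eqP -> : s == [::] by rewrite -size_eq0 -leqn0.
  rewrite expr0 !divr1 subr0 distrC.
  have := @sdecimal_bound R t; rewrite ler_norml => /andP[_ h].
  by rewrite ger0_norm; lra.
have E (u : seq (option bool)) : sdecimal u =
    (sdigit (odflt None (ohead u)) + sdecimal (behead u)) / 10 :> R.
  by case: u => [|d u] //=; rewrite addr0 mul0r.
rewrite (E s) (E t).
have bs : (size (behead s) <= k)%N by rewrite size_behead -subn1 leq_subLR add1n.
have [bt bbs] := (@sdecimal_bound R (behead t), @sdecimal_bound R (behead s)).
have {ih} := ih _ (behead t) bs.
set v := sdecimal (behead t) in bt *; set w := sdecimal (behead s) in bbs *.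
have p0 : 0 < (10 ^+ k : R)^-1 by rewrite invr_gt0 exprn_gt0.
have p1 : (10 ^+ k : R)^-1 <= 1 by rewrite invf_le1 ?exprn_gt0// exprn_ege1// ler1n.
rewrite exprS invfM; move: p0 p1; move: (10 ^+ k)^-1 => p p0 p1 ih.
move: bt bbs; rewrite !ler_norml => /andP[v1 v2] /andP[w1 w2].
set c := sdigit _; set d := sdigit (odflt _ _).
rewrite (_ : _ - _ = (c - d + (v - w - 2 / 5 * p)) / 10); last by field.
rewrite normrM (@ger0_norm _ (10^-1)) ?invr_ge0//.
suff : 1 / 5 * p <= `|c - d + (v - w - 2 / 5 * p)| by lra.
have [->|cd] := eqVneq c d; first by rewrite subrr add0r.
have : c - d <= -1 \/ 1 <= c - d.
  move: cd; rewrite /c /d; case: (odflt _ _) => [[]|]; case: (odflt _ _) => [[]|] /=;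
    by rewrite ?eqxx//; lra.
case=> h; first by rewrite ler0_norm; lra.
by rewrite ger0_norm; lra.
Qed.

(** * A slowly varying modulus *)

(** Essentially [1 / ln (1 / t)], whose values at [t] and [10 * t] are asymptotic
    to each other as [t] tends to [0].  The shift by [e] makes it bounded by [1]
    and concave enough on the whole half-line. *)
Definition logmod {R : realType} (t : R) : R := (ln (expR 1 + t^-1))^-1.

Lemma logmod_ln_gt1 {R : realType} (t : R) : 0 < t -> 1 < ln (expR 1 + t^-1).
Proof.
move=> t0; have ti : 0 < t^-1 by rewrite invr_gt0.
by rewrite -[X in X < _](expRK (1 : R)) ltr_ln ?posrE ?expR_gt0 ?addr_gt0 ?expR_gt0// ltrDl.
Qed.

Lemma logmod_gt0 {R : realType} (t : R) : 0 < t -> 0 < logmod t.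
Proof. by move=> /logmod_ln_gt1 h; rewrite invr_gt0 (lt_trans _ h). Qed.

Lemma logmod_le1 {R : realType} (t : R) : 0 < t -> logmod t <= 1.
Proof. by move=> /logmod_ln_gt1 h; rewrite invf_le1 ?ltW// (lt_trans _ h). Qed.

Lemma logmod_lt {R : realType} (s t : R) : 0 < s -> s < t -> logmod s < logmod t.
Proof.
move=> s0 st; have t0 := lt_trans s0 st.
have [ls lt_] := (logmod_ln_gt1 s0, logmod_ln_gt1 t0).
rewrite ltf_pV2 ?posrE; [|by lra..].
rewrite ltr_ln ?posrE ?addr_gt0 ?expR_gt0 ?invr_gt0// ltrD2l.
by rewrite ltf_pV2 ?posrE.
Qed.

Lemma ln_shift_sub {R : realType} (s t : R) : 0 < s -> s <= t ->
  ln (expR 1 + s^-1) - ln (expR 1 + t^-1) <= t / s - 1.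
Proof.
move=> s0 st; have t0 := lt_le_trans s0 st; have e0 := expR_gt0 (1 : R).
have es : 0 < expR 1 + s^-1 by rewrite addr_gt0 ?invr_gt0.
have et : 0 < expR 1 + t^-1 by rewrite addr_gt0 ?invr_gt0.
rewrite -ln_div ?posrE//.
apply: (@le_trans _ _ ((expR 1 + s^-1) / (expR 1 + t^-1) - 1)).
  rewrite -[X in ln X](subrKC 1); apply: le_ln1Dx.
  by rewrite ltrBrDl subrr divr_gt0.
rewrite lerD2r ler_pdivrMr// mulrDr (_ : t / s * t^-1 = s^-1); last first.
  by field; rewrite !gt_eqF.
rewrite lerD2r.
by rewrite ler_peMl ?(ltW e0)// ler_pdivlMr ?mul1r.
Qed.

(** [logmod t / t] decreases: [t * ln (e + 1 / t)] increases since
    [ln (e + 1 / t) >= 1]. *)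
Lemma logmod_ratio {R : realType} (s t : R) : 0 < s -> s <= t ->
  logmod t * s <= logmod s * t.
Proof.
move=> s0 st; have t0 := lt_le_trans s0 st.
have := ln_shift_sub s0 st; rewrite lerBlDr -(ler_pM2l s0).
have := logmod_ln_gt1 s0; have := logmod_ln_gt1 t0; rewrite /logmod.
set a := ln _; set b := ln _ => a1 b1.
rewrite (_ : s * (_ + _) = t - s + s * a); last by field; rewrite gt_eqF.
move=> h; have ab : 0 < a * b by nra.
rewrite -(ler_pM2r ab) [leLHS](_ : _ = s * b); last by field; rewrite gt_eqF//; lra.
rewrite [leRHS](_ : _ = t * a); last by field; rewrite gt_eqF//; lra.
nra.
Qed.

Lemma logmod_incr {R : realType} (s t : R) : 0 < s -> s <= t ->
  logmod t - logmod s <= logmod s * logmod t * (t / s - 1).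
Proof.
move=> s0 st; have t0 := lt_le_trans s0 st.
have := ln_shift_sub s0 st; have := logmod_ln_gt1 s0; have := logmod_ln_gt1 t0.
rewrite /logmod; set a := ln _; set b := ln _ => a1 b1 h.
rewrite (_ : a^-1 - b^-1 = b^-1 * a^-1 * (b - a)).
  by rewrite ler_pM2l// mulr_gt0// invr_gt0; lra.
by field; rewrite !gt_eqF//; lra.
Qed.

Lemma logmod_cvg0 {R : realType} (e : R) : 0 < e ->
  exists2 d, 0 < d & forall t, 0 < t -> t < d -> logmod t <= e.
Proof.
move=> e0; exists (expR (- e^-1)); first exact: expR_gt0.
move=> t t0 td; rewrite /logmod invf_ple ?posrE//; last first.
  by have := logmod_ln_gt1 t0; lra.
have ti : expR e^-1 <= t^-1.
  by rewrite -[e^-1]opprK expRN lef_pV2 ?posrE ?expR_gt0// ltW.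
rewrite -[e^-1]expRK ler_ln ?posrE ?expR_gt0 ?addr_gt0 ?invr_gt0 ?expR_gt0//.
by have := expR_gt0 (1 : R); lra.
Qed.

(** Since [ln u <= 2 * Num.sqrt u], one has
    [t / logmod t <= 2 * t * Num.sqrt (e + 1 / t)], which tends to [0]. *)
Lemma logmod_steep {R : realType} (e : R) : 0 < e ->
  exists2 d, 0 < d & forall t, 0 < t -> t < d -> t <= e * logmod t.
Proof.
move=> e0; exists (Num.min 1 (e ^+ 2 / (4 * (expR 1 + 1)))).
  by rewrite lt_min ltr01 divr_gt0 ?exprn_gt0// mulr_gt0// addr_gt0 ?expR_gt0.
move=> t t0; rewrite lt_min => /andP[t1].
have E0 := expR_gt0 (1 : R).
rewrite ltr_pdivlMr ?mulr_gt0 ?addr_gt0// => te.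
have l1 := logmod_ln_gt1 t0; rewrite /logmod ler_pdivlMr; last by lra.
have a0 : 0 < expR 1 + t^-1 by rewrite addr_gt0 ?invr_gt0.
have la : ln (expR 1 + t^-1) <= 2 * Num.sqrt (expR 1 + t^-1).
  rewrite -[X in ln X](sqr_sqrtr (ltW a0)) lnXn ?sqrtr_gt0// mulr_natl lerMn2r/=.
  by rewrite ltW// ln_sublinear// sqrtr_gt0.
apply: (@le_trans _ _ (t * (2 * Num.sqrt (expR 1 + t^-1)))).
  by rewrite ler_pM2l.
rewrite -(@ler_pXn2r _ 2)// ?nnegrE ?mulr_ge0 ?sqrtr_ge0 ?ltW//.
rewrite !exprMn sqr_sqrtr ?ltW//.
rewrite (_ : t ^+ 2 * _ = t * (4 * (expR 1 * t + 1))); last by field; rewrite gt_eqF.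
apply: le_lt_trans te.
by rewrite ler_pM2l// ler_pM2l// lerD2r ler_piMr// ltW.
Qed.

Definition slow {R : realType} (t : R) : R := Num.sg t * logmod `|t|.

Lemma slow0 {R : realType} : slow (0 : R) = 0.
Proof. by rewrite /slow sgr0 mul0r. Qed.

Lemma slowN {R : realType} (t : R) : slow (- t) = - slow t.
Proof. by rewrite /slow sgrN normrN mulNr. Qed.

Lemma slow_pos {R : realType} (t : R) : 0 < t -> slow t = logmod t.
Proof. by move=> t0; rewrite /slow gtr0_sg// mul1r gtr0_norm. Qed.

Lemma slow_gt0 {R : realType} (t : R) : 0 < t -> 0 < slow t.
Proof. by move=> t0; rewrite slow_pos// logmod_gt0. Qed.

Lemma slow_lt {R : realType} (s t : R) : s < t -> slow s < slow t.
Proof.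
have pos (x y : R) : 0 <= x -> x < y -> slow x < slow y.
  rewrite le_eqVlt => /orP[/eqP <- y0|x0 xy]; first by rewrite slow0 slow_gt0.
  by have y0 := lt_trans x0 xy; rewrite !slow_pos// logmod_lt.
have [s0|s0] := leP 0 s; first exact: pos.
have [t0|t0] := leP t 0.
  by rewrite -ltrN2 => st; rewrite -ltrN2 -!slowN pos// oppr_ge0.
by move=> _; apply: (@lt_trans _ _ 0); rewrite ?slow_gt0// -oppr_gt0 -slowN slow_gt0// oppr_gt0.
Qed.

Lemma slow_le {R : realType} (s t : R) : s <= t -> slow s <= slow t.
Proof. by rewrite le_eqVlt => /orP[/eqP ->//|/slow_lt/ltW]. Qed.

Lemma slow_le1 {R : realType} (t : R) : `|slow t| <= 1.
Proof.
rewrite /slow normrM normr_sg; have [->|t0] := eqVneq t 0; first by rewrite mul0r.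
by rewrite mul1r gtr0_norm ?logmod_gt0 ?normr_gt0// logmod_le1 ?normr_gt0.
Qed.

(** Subadditivity on the half-line, a consequence of [logmod_ratio], makes the
    increments of [slow] largest at [0], up to the factor 2 due to the two sides
    of [0]. *)
Lemma slow_increment {R : realType} (x s : R) : 0 < s ->
  slow (x + s) - slow x <= 2 * logmod s.
Proof.
have sub (a b : R) : 0 <= a -> 0 < b -> slow (a + b) <= slow a + logmod b.
  rewrite le_eqVlt => /orP[/eqP <- b0|a0 b0]; first by rewrite slow0 !add0r slow_pos.
  have ab : 0 < a + b by rewrite addr_gt0.
  rewrite !slow_pos// -(ler_pM2r ab) mulrDr mulrDl.
  apply: lerD; rewrite logmod_ratio// ?lerDl ?lerDr ltW//.
move=> s0; have l0 := logmod_gt0 s0.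
have [x0|x0] := leP 0 x; first by have := sub x s x0 s0; lra.
have [y0|y0] := leP (x + s) 0.
  have := sub (- (x + s)) s; rewrite oppr_ge0 => /(_ y0 s0).
  by rewrite (_ : - (x + s) + s = - x) ?slowN; [lra|ring].
have h1 : slow (x + s) <= logmod s by rewrite -slow_pos// slow_le//; lra.
have h2 : slow (- x) <= logmod s by rewrite -slow_pos// slow_le//; lra.
by move: h2; rewrite slowN; lra.
Qed.

Lemma logmod_scale9 {R : realType} (t : R) : 0 < t -> logmod (9 * t) <= 9 * logmod t.
Proof.
move=> t0; rewrite -(ler_pM2r t0).
have -> : 9 * logmod t * t = logmod t * (9 * t) by ring.
by apply: logmod_ratio => //; lra.
Qed.

(** At [d = 0] this is slow variation.  Away from [0] the function [slow] is
    Lipschitz, and [t] is negligible with respect to [logmod t]. *)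
Lemma slow_slow {R : realType} (d e : R) : 0 < e ->
  exists2 del, 0 < del & forall t, 0 < t -> t < del ->
    slow (d + 10 * t) - slow (d + t) <= e * logmod t.
Proof.
move=> e0.
have pos (x y : R) : 0 < x -> x <= y -> slow y - slow x <= logmod x * logmod y * ((y - x) / x).
  move=> x0 xy; have y0 := lt_le_trans x0 xy.
  rewrite !slow_pos//; apply: le_trans (logmod_incr x0 xy) _.
  by rewrite mulrBl divff// gt_eqF.
have [->|d0] := eqVneq d 0.
  have [del del0 hdel] := @logmod_cvg0 R (e / 9) (divr_gt0 e0 (ltr0n _ 9)).
  exists (del / 10) => [|t t0 td]; first by rewrite divr_gt0.
  rewrite !add0r; apply: le_trans (pos t (10 * t) t0 _) _; first lra.
  rewrite (_ : (10 * t - t) / t = 9); last by field; rewrite gt_eqF.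
  have := hdel (10 * t); rewrite pmulr_rgt0// => /(_ t0) h.
  have {}h : logmod (10 * t) <= e / 9 by apply: h; lra.
  by have := logmod_gt0 t0; nra.
have nd : 0 < `|d| by rewrite normr_gt0.
have [del del0 hdel] := @logmod_steep R (e * `|d| / 18) (divr_gt0 (mulr_gt0 e0 nd) (ltr0n _ 18)).
exists (Num.min del (`|d| / 20)) => [|t t0]; first by rewrite lt_min del0 divr_gt0.
rewrite lt_min => /andP[/(hdel _ t0) ht td].
have main (x y : R) : `|d| / 2 <= x -> y - x = 9 * t -> slow y - slow x <= e * logmod t.
  move=> dx yx; have x0 : 0 < x by apply: lt_le_trans dx; rewrite divr_gt0.
  have xy : x <= y by lra.
  have y0 := lt_le_trans x0 xy.
  apply: le_trans (pos x y x0 xy) _; rewrite yx.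
  apply: (@le_trans _ _ (9 * t / x)).
    apply: ler_piMl; first by apply: divr_ge0; [lra|exact: ltW].
    by apply: mulr_ile1; rewrite ?logmod_le1// ltW// logmod_gt0.
  rewrite ler_pdivrMr//; apply: (@le_trans _ _ (9 * (e * `|d| / 18 * logmod t))).
    by rewrite ler_pM2l.
  rewrite (_ : 9 * _ = e * logmod t * (`|d| / 2)); last by field.
  by rewrite ler_wpM2l// mulr_ge0 ?ltW ?logmod_gt0.
have [dp|dn] := ltP 0 d.
  by move: td main; rewrite gtr0_norm// => td main; apply: main; lra.
rewrite (_ : slow _ - _ = slow (- (d + t)) - slow (- (d + 10 * t))); last first.
  by rewrite !slowN opprK addrC.
by move: td main; rewrite ler0_norm// => td main; apply: main; lra.
Qed.

(** * A homeomorphism of the interval that is slowly varying on a countable set *)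

Definition wsum {R : realType} (f : nat -> R) : R :=
  limn (series (fun k => f k / 2 ^+ k.+1)).

Lemma sum_weights {R : realType} (K n : nat) : (K <= n)%N ->
  \sum_(K <= k < n) (2 ^+ k.+1)^-1 = (2 ^+ K)^-1 - (2 ^+ n)^-1 :> R.
Proof.
move=> Kn; rewrite -(subnK Kn); elim: (n - K)%N => [|l ih].
  by rewrite add0n big_geq// subrr.
rewrite addSn big_nat_recr ?leq_addl//= ih exprS; field.
by rewrite !expf_neq0.
Qed.

Lemma wsum_cvg {R : realType} (f : nat -> R) : (forall k, `|f k| <= 1) ->
  cvgn (series (fun k => f k / 2 ^+ k.+1)).
Proof.
move=> f1; apply: normed_cvg.
apply: (@series_le_cvg _ _ (geometric 1 2^-1)) => [k|k|k|].
- exact: normr_ge0.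
- by rewrite /geometric/= mul1r exprn_ge0// invr_ge0.
- rewrite /geometric/= mul1r normrM (@ger0_norm _ _^-1) ?invr_ge0 ?exprn_ge0//.
  rewrite exprVn; apply: (@le_trans _ _ (2 ^+ k.+1)^-1).
    by rewrite ler_piMl// invr_ge0 exprn_ge0.
  by rewrite lef_pV2 ?posrE ?exprn_gt0// exprS ler_peMl ?exprn_ge0// ler1n.
- by apply: is_cvg_geometric_series; rewrite ger0_norm ?invr_ge0// invf_lt1// ltr1n.
Qed.

Lemma wsum_sub_le {R : realType} (f g : nat -> R) (M : R) (N : nat) :
  (forall k, `|f k| <= 1) -> (forall k, `|g k| <= 1) ->
  (forall n, (N <= n)%N -> \sum_(0 <= k < n) (f k - g k) / 2 ^+ k.+1 <= M) ->
  wsum f - wsum g <= M.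
Proof.
move=> f1 g1 hM; rewrite /wsum -limB; [|exact: wsum_cvg..].
apply: limr_le; first by apply: is_cvgB; exact: wsum_cvg.
exists N => // n /= Nn; apply: le_trans (hM n Nn).
rewrite fctE /series/= -sumrB le_eqVlt; apply/orP; left; apply/eqP.
by apply: eq_bigr => k _; rewrite mulrBl.
Qed.

Lemma wsumN {R : realType} (f : nat -> R) : (forall k, `|f k| <= 1) ->
  wsum (fun k => - f k) = - wsum f.
Proof.
move=> f1; rewrite /wsum -limN; last exact: wsum_cvg.
congr (limn _).
by apply/funext => n; rewrite /series/= fctE -sumrN; apply: eq_bigr => k _; rewrite mulNr.
Qed.

(** A strictly increasing function that is slowly varying at each [q k]. *)
Definition slow_sum {R : realType} (q : nat -> R) (x : R) : R :=
  wsum (fun k => slow (x - q k)).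

Lemma slow_sumN {R : realType} (q : nat -> R) (x : R) :
  slow_sum (fun k => - q k) (- x) = - slow_sum q x.
Proof.
rewrite /slow_sum -wsumN => [|k]; last exact: slow_le1.
by congr wsum; apply/funext => k; rewrite -slowN opprB opprK addrC.
Qed.

Lemma slow_sum_increment {R : realType} (q : nat -> R) (x s : R) : 0 < s ->
  slow_sum q (x + s) - slow_sum q x <= 2 * logmod s.
Proof.
move=> s0; apply: (@wsum_sub_le _ _ _ _ 0) => [k|k|n _]; [exact: slow_le1..|].
have l0 : 0 <= 2 * logmod s by rewrite mulr_ge0// ltW// logmod_gt0.
apply: (@le_trans _ _ (\sum_(0 <= k < n) 2 * logmod s * (2 ^+ k.+1)^-1)).
  apply: ler_sum => k _; rewrite ler_wpM2r ?invr_ge0 ?exprn_ge0//.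
  by rewrite addrAC slow_increment.
rewrite -mulr_sumr sum_weights// expr0 invr1 ler_piMr// gerBl invr_ge0 exprn_ge0//.
Qed.

Lemma slow_sum_lower {R : realType} (q : nat -> R) (x y : R) i : x <= y ->
  (slow (y - q i) - slow (x - q i)) / 2 ^+ i.+1 <= slow_sum q y - slow_sum q x.
Proof.
move=> xy; rewrite -lerN2 opprB.
apply: (@wsum_sub_le _ _ _ _ i.+1) => [k|k|n iN]; [exact: slow_le1..|].
rewrite big_mkord (bigD1 (Ordinal iN))//=.
rewrite [leRHS](_ : _ = (slow (x - q i) - slow (y - q i)) / 2 ^+ i.+1); last by ring.
rewrite gerDl.
apply: sumr_le0 => k _; rewrite mulr_le0_ge0 ?invr_ge0 ?exprn_ge0//.
by rewrite subr_le0 slow_le// lerD2r.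
Qed.

Lemma slow_sum_lt {R : realType} (q : nat -> R) (x y : R) : x < y ->
  slow_sum q x < slow_sum q y.
Proof.
move=> xy; rewrite -subr_gt0; apply: lt_le_trans (slow_sum_lower q 0 (ltW xy)).
by rewrite divr_gt0 ?exprn_gt0// subr_gt0 slow_lt// ltrD2r.
Qed.

(** At [q i] the increment on the right is at least a fixed multiple of
    [logmod t], due to the term of index [i].  On the left, finitely many terms
    are negligible with respect to [logmod t] by [slow_slow], and the tail is a
    small multiple of [logmod t] by [slow_increment]. *)
Lemma slow_sum_slow {R : realType} (q : nat -> R) i (e : R) : 0 < e ->
  exists2 del, 0 < del & forall t, 0 < t -> t < del ->
    slow_sum q (q i + 10 * t) - slow_sum q (q i + t) <=
    e * (slow_sum q (q i + t) - slow_sum q (q i)).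
Proof.
move=> e0; pose e1 := e / 2 ^+ i.+1.
have e10 : 0 < e1 by rewrite divr_gt0// exprn_gt0.
have [K hK] : exists K, 36 / e1 < 2 ^+ K.
  exists (Num.truncn (36 / e1)).+1; apply: lt_trans (truncnS_gt _) _.
  by rewrite -natrX ltr_nat ltn_expl.
have [||del del0 hdel] := @common_pos_bound R (fun k del => forall t, 0 < t -> t < del ->
    slow (q i - q k + 10 * t) - slow (q i - q k + t) <= e1 / 2 * logmod t) K.
- by move=> k d d' _ d'd h t t0 td; apply: h => //; exact: lt_le_trans d'd.
- move=> k; have [|del del0 h] := @slow_slow R (q i - q k) (e1 / 2).
    by rewrite divr_gt0.
  by exists del.
exists del => // t t0 td; have l0 := logmod_gt0 t0.
apply: (@le_trans _ _ (e1 * logmod t)); last first.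
  have h : q i <= q i + t by rewrite lerDl ltW.
  have := slow_sum_lower q i h.
  rewrite subrr slow0 subr0 addrAC subrr add0r slow_pos// => {}h.
  by rewrite /e1 -mulrA ler_pM2l// mulrC.
apply: (@wsum_sub_le _ _ _ _ K) => [k|k|n Kn]; [exact: slow_le1..|].
rewrite (big_cat_nat (n := K))//=.
rewrite (_ : e1 * logmod t = e1 / 2 * logmod t + e1 / 2 * logmod t); last by field.
apply: lerD.
  apply: (@le_trans _ _ (\sum_(0 <= k < K) e1 / 2 * logmod t * (2 ^+ k.+1)^-1)).
    rewrite big_nat_cond [leRHS]big_nat_cond; apply: ler_sum => k /andP[/andP[_ kK] _].
    rewrite ler_wpM2r ?invr_ge0 ?exprn_ge0//.
    by rewrite (addrAC _ (10 * t)) (addrAC _ t) hdel.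
  rewrite -mulr_sumr sum_weights// expr0 invr1 ler_piMr ?gerBl ?invr_ge0 ?exprn_ge0//.
  by rewrite mulr_ge0 ?ltW// divr_gt0.
apply: (@le_trans _ _ (\sum_(K <= k < n) 18 * logmod t * (2 ^+ k.+1)^-1)).
  apply: ler_sum => k _; rewrite ler_wpM2r ?invr_ge0 ?exprn_ge0//.
  have t9 : 0 < 9 * t by rewrite mulr_gt0.
  have := slow_increment (q i + t - q k) t9.
  rewrite (_ : q i + t - q k + 9 * t = q i + 10 * t - q k); last by ring.
  by have := logmod_scale9 t0; lra.
rewrite -mulr_sumr sum_weights//.
apply: (@le_trans _ _ (18 * logmod t * (2 ^+ K)^-1)).
  by rewrite ler_wpM2l ?mulr_ge0 ?(ltW l0)// gerBl invr_ge0 exprn_ge0.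
rewrite (mulrAC 18) ler_pM2r// ler_pdivrMr ?exprn_gt0//.
by move: hK; rewrite ltr_pdivrMr//; lra.
Qed.

(** What a change of latitude needs in order to extend continuously to the poles
    and to be invertible there. *)
Definition interval_map {R : realType} (h : R -> R) :=
  [/\ forall t, `|t| = 1 -> h t = t, forall t, `|t| < 1 -> `|h t| < 1 &
      forall t e, `|t| <= 1 -> 0 < e -> exists2 d, 0 < d &
        forall s, `|s| <= 1 -> `|s - t| < d -> `|h s - h t| < e].

Definition slowly_varying {R : realType} (g : R -> R) :=
  forall e, 0 < e -> exists2 d, 0 < d & forall t, 0 < t -> t < d ->
    g (10 * t) - g t <= e * g t.

Lemma normalized_slow_sum {R : realType} (q : nat -> R) : exists h : R -> R,
  [/\ forall x y, x < y -> h x < h y, h 1 = 1 /\ h (- 1) = - 1,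
      forall x e, 0 < e -> exists2 d, 0 < d & forall y, `|y - x| < d -> `|h y - h x| < e,
      forall i, slowly_varying (fun t => h (q i + t) - h (q i)) &
      forall i, slowly_varying (fun t => h (q i) - h (q i - t))].
Proof.
pose H := slow_sum q; pose W := H 1 - H (- 1).
have W0 : 0 < W by rewrite subr_gt0 slow_sum_lt// ltrN10.
pose h x := (2 * H x - H 1 - H (- 1)) / W.
have hB x y : h x - h y = 2 / W * (H x - H y) by rewrite /h; field; rewrite gt_eqF.
have W2 : 0 < 2 / W by rewrite divr_gt0.
have hlt x y : x < y -> h x < h y.
  by move=> xy; rewrite -subr_gt0 hB mulr_gt0// subr_gt0 slow_sum_lt.
exists h; split=> //.
- by split; rewrite /h /W; field; rewrite gt_eqF.
- move=> x e e0; have e40 : 0 < e / (2 * (2 / W)) / 2 by rewrite !divr_gt0// mulr_gt0.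
  have [d d0 hd] := logmod_cvg0 e40.
  have main y z : y < z -> z - y < d -> h z - h y < e.
    move=> yz zd; rewrite hB -ltr_pdivlMl//.
    have zy0 : 0 < z - y by rewrite subr_gt0.
    have := slow_sum_increment q y zy0; rewrite subrKC => /le_lt_trans; apply.
    have lm := hd _ zy0 zd; apply: (@le_lt_trans _ _ (2 * (e / (2 * (2 / W)) / 2))).
      by rewrite ler_pM2l.
    rewrite [ltLHS](_ : _ = (2 / W)^-1 * e / 2); last by field; rewrite gt_eqF.
    by rewrite ltr_pdivrMr// ltr_pMr ?ltr1n// mulr_gt0// invr_gt0.
  exists d => // y; case: (ltgtP x y) => [xy|yx|->].
  + rewrite gtr0_norm ?subr_gt0// => yd.
    by rewrite gtr0_norm ?subr_gt0 ?hlt// main.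
  + rewrite distrC gtr0_norm ?subr_gt0// => yd.
    by rewrite distrC gtr0_norm ?subr_gt0 ?hlt// main.
  + by rewrite !subrr normr0.
- move=> i e e0; have [d d0 hd] := slow_sum_slow q i e0.
  exists d => // t t0 td.
  rewrite [leLHS](_ : _ = h (q i + 10 * t) - h (q i + t)); last by ring.
  by rewrite !hB mulrCA ler_pM2l// hd.
- move=> i e e0; have [d d0 hd] := slow_sum_slow (fun k => - q k) i e0.
  exists d => // t t0 td.
  rewrite [leLHS](_ : _ = h (q i - t) - h (q i - 10 * t)); last by ring.
  rewrite !hB mulrCA ler_pM2l//.
  have := hd t t0 td.
  rewrite (_ : - q i + 10 * t = - (q i - 10 * t)); last by ring.
  rewrite (_ : - q i + t = - (q i - t)); last by ring.
  by rewrite !slow_sumN -/H; lra.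
Qed.

Lemma interval_map_inverse {R : realType} (h : R -> R) :
  (forall x y, x < y -> h x < h y) -> h 1 = 1 -> h (- 1) = - 1 ->
  (forall x e, 0 < e -> exists2 d, 0 < d & forall y, `|y - x| < d -> `|h y - h x| < e) ->
  exists g, [/\ interval_map h, interval_map g, forall t, `|t| <= 1 -> g (h t) = t &
    forall t, `|t| <= 1 -> h (g t) = t].
Proof.
move=> hlt h1 hN1 hcont.
have hle x y : x <= y -> h x <= h y.
  by rewrite le_eqVlt => /orP[/eqP ->|/hlt/ltW].
have hlt_inv x y : h x < h y -> x < y.
  by apply: contraTT; rewrite -!leNgt; exact: hle.
have /choice[g hg] : forall y, exists x, `|y| <= 1 -> `|x| <= 1 /\ h x = y.
  move=> y; have [y1|] := pselect (`|y| <= 1); last by exists 0.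
  have [|||x xI <-] := @IVT R h (- 1) 1 y.
  - by rewrite ge0_cp.
  - apply: continuous_subspaceT => x; apply/cvgrPdist_lt => e e0.
    have [d d0 hd] := hcont x e e0.
    by apply/nbhs_ballP; exists d => // z; rewrite /ball/= distrC => /hd; rewrite distrC.
  - by rewrite h1 hN1 ge_min le_max; move: y1; rewrite ler_norml => /andP[-> ->]; rewrite orbT.
  by exists x => _; rewrite ler_norml; split=> //; move: xI; rewrite in_itv.
exists g.
have gh t : `|t| <= 1 -> g (h t) = t.
  move=> t1; have ht : `|h t| <= 1.
    move: t1; rewrite !ler_norml => /andP[a b].
    by apply/andP; split; [rewrite -hN1|rewrite -[leRHS]h1]; exact: hle.
  have [_ E] := hg _ ht; apply/eqP; rewrite eq_le !leNgt.
  by apply/andP; split; apply/negP => /hlt; rewrite E ltxx.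
have hh1 t : `|t| = 1 -> h t = t.
  by move=> t1; have [t0|t0] := leP 0 t; move: t1;
    [rewrite ger0_norm// => ->|rewrite ltr0_norm// => /(canRL (@opprK R)) ->].
split=> //.
- split=> // [t|t e _ e0].
    rewrite !ltr_norml => /andP[a b].
    by apply/andP; split; [rewrite -hN1|rewrite -[ltRHS]h1]; exact: hlt.
  by have [d d0 hd] := hcont t e e0; exists d => // s _; exact: hd.
- split=> [t t1|t t1|t e t1 e0].
  + by rewrite -{1}(hh1 t t1) gh// t1.
  + have [gt1 E] := hg t (ltW t1).
    move: t1; rewrite -{1}E !ltr_norml => /andP[a b].
    apply/andP; split; apply: hlt_inv; first by rewrite hN1.
    by rewrite h1.
  + have [gt1 E] := hg t t1.
    exists (Num.min (h (g t + e) - t) (t - h (g t - e))).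
      by rewrite lt_min !subr_gt0 -{1 4}E !hlt// ?ltrDl// ltrBlDl ltrDr.
    move=> s s1; rewrite lt_min => /andP[]; rewrite !ltr_norml => /andP[_ a] /andP[b _].
    have [_ Es] := hg s s1.
    have {}a : h (g s) < h (g t + e) by rewrite Es; lra.
    have {}b : h (g t - e) < h (g s) by rewrite Es; lra.
    by move/hlt_inv: a; move/hlt_inv: b; lra.
- by move=> t t1; case: (hg t t1).
Qed.

(** Slow variation in multiplicative scale: the values of [g] at the powers of
    1/10 leave no gaps comparable to the distance to [0]. *)
Lemma slowly_varying_hits {R : realType} (g : R -> R) N (e : R) :
  (forall t, 0 < t -> 0 < g t) ->
  (forall u, 0 < u -> exists2 d, 0 < d & forall t, 0 < t -> t < d -> g t < u) ->
  slowly_varying g -> 0 < e ->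
  exists2 s0, 0 < s0 & forall u, 0 < u -> u < s0 ->
    exists2 k, (N <= k)%N & `|g (1 / 10 ^+ k.+1) - u| <= e * u.
Proof.
move=> g0 gcvg gs e0; have [d d0 hd] := gs e e0.
have small (a : R) : 0 < a -> exists K, forall k, (K <= k)%N -> 1 / 10 ^+ k.+1 < a.
  move=> a0; exists (Num.truncn a^-1).+1 => k Kk.
  rewrite div1r invf_plt ?posrE ?exprn_gt0//; apply: lt_trans (truncnS_gt _) _.
  rewrite -natrX ltr_nat; apply: leq_ltn_trans Kk _.
  by apply: leq_trans (ltn_expl k (isT : (1 < 10)%N)) _; rewrite leq_exp2l.
have [K hK] := small d d0.
pose L := maxn N K.
have tp k : 0 < (1 / 10 ^+ k.+1 : R) by rewrite divr_gt0// exprn_gt0.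
exists (g (1 / 10 ^+ L.+1)); first exact: g0.
move=> u u0 us; have [d' d'0 hd'] := gcvg u u0; have [K' hK'] := small d' d'0.
have exP : exists k, (L <= k)%N && (g (1 / 10 ^+ k.+1) <= u).
  exists (maxn L K'); rewrite leq_maxl/= ltW// hd'// hK'// leq_maxr//.
case: (ex_minnP exP) => k /andP[Lk gu] kmin.
have Lk' : (L < k)%N.
  rewrite ltn_neqAle Lk andbT; apply: contraTneq gu => <-.
  by rewrite -ltNge.
exists k; first exact: leq_trans (leq_trans (leq_maxl _ _) Lk).
have gk : u < g (1 / 10 ^+ k).
  rewrite ltNge; apply/negP => h; case: k Lk gu kmin Lk' h => // k _ _ kmin Lk' h.
  by have := kmin k; rewrite -ltnS Lk' h => /(_ isT); rewrite ltnn.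
have tk : 10 * (1 / 10 ^+ k.+1) = 1 / 10 ^+ k :> R.
  by rewrite exprS; field; rewrite expf_neq0.
have := hd _ (tp k) (hK k _); rewrite tk => /(_ (leq_trans (leq_maxr N K) Lk)) h.
rewrite ler0_norm ?subr_le0// opprB.
have := ler_wpM2l (ltW e0) gu; lra.
Qed.

(** * Homeomorphisms of the sphere that act on one coordinate *)

Definition axis {R : realType} {m} : 'rV[R]_m.+1 := delta_mx 0 0.

Definition axial {R : realType} {m} (x : 'rV[R]_m.+1) : R := edot x axis.

Definition offaxis {R : realType} {m} (x : 'rV[R]_m.+1) := x - axial x *: axis.

(** The point of the sphere with first coordinate [a] on the meridian of [x]. *)
Definition slide {R : realType} {m} (x : 'rV[R]_m.+1) (a : R) :=
  a *: axis + (Num.sqrt (1 - a ^+ 2) / enorm (offaxis x)) *: offaxis x.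

Lemma edot_axis {R : realType} m : edot (@axis R m) axis = 1 /\ enorm (@axis R m) = 1.
Proof.
suff E : edot (@axis R m) axis = 1 by rewrite /enorm E sqrtr1.
rewrite /edot (bigD1 0)//= big1 ?addr0; first by rewrite !mxE !eqxx mulr1.
by move=> i i0; rewrite !mxE eqxx/= (negbTE i0) mul0r.
Qed.

Lemma axialD {R : realType} m (x y : 'rV[R]_m.+1) : axial (x + y) = axial x + axial y.
Proof. exact: edotDl. Qed.

Lemma axialZ {R : realType} m a (x : 'rV[R]_m.+1) : axial (a *: x) = a * axial x.
Proof. exact: edotZl. Qed.

Lemma axial_axis {R : realType} m : axial (@axis R m) = 1.
Proof. by case: (edot_axis (R := R) m). Qed.

Lemma axial_offaxis {R : realType} m (x : 'rV[R]_m.+1) : axial (offaxis x) = 0.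
Proof. by rewrite /offaxis -scaleNr axialD axialZ axial_axis mulr1 addrN. Qed.

Lemma axial_lipschitz {R : realType} m (x y : 'rV[R]_m.+1) :
  `|axial x - axial y| <= enorm (x - y).
Proof. by have := edot_lipschitz axis x y; rewrite (edot_axis m).2 mul1r. Qed.

Lemma offaxisB {R : realType} m (x y : 'rV[R]_m.+1) :
  offaxis x - offaxis y = offaxis (x - y).
Proof.
have c : axial (x - y) = axial x - axial y by rewrite /axial !edotE.
by rewrite /offaxis c; apply/rowP => i; rewrite !mxE; ring.
Qed.

Lemma offaxis_sqr {R : realType} m (x : 'rV[R]_m.+1) :
  enorm (offaxis x) ^+ 2 = enorm x ^+ 2 - axial x ^+ 2.
Proof.
rewrite !enorm_sqr /offaxis !edotE (edot_axis m).1 (edotC axis x) -/(axial x).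
ring.
Qed.

Lemma offaxis_le {R : realType} m (x : 'rV[R]_m.+1) : enorm (offaxis x) <= enorm x.
Proof.
rewrite -(@ler_pXn2r _ 2)// ?nnegrE ?enorm_ge0// offaxis_sqr gerBl sqr_ge0//.
Qed.

Lemma axis_decomposition {R : realType} m (x : 'rV[R]_m.+1) :
  x = axial x *: axis + offaxis x.
Proof. by rewrite addrC subrK. Qed.

Lemma axial_sphere {R : realType} m (x : 'rV[R]_m.+1) :
  ideal_sphere R m x -> `|axial x| <= 1.
Proof. by move=> x1; have := ler_edot x axis; rewrite x1 (edot_axis m).2 mulr1. Qed.

Lemma offaxis_sphere {R : realType} m (x : 'rV[R]_m.+1) :
  ideal_sphere R m x -> enorm (offaxis x) = Num.sqrt (1 - axial x ^+ 2).
Proof.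
move=> x1; rewrite -[1](expr1n R 2) -x1 -offaxis_sqr sqrtr_sqr ger0_norm//.
exact: enorm_ge0.
Qed.

Lemma offaxis_gt0 {R : realType} m (x : 'rV[R]_m.+1) :
  ideal_sphere R m x -> `|axial x| < 1 -> 0 < enorm (offaxis x).
Proof.
move=> x1 c1; rewrite offaxis_sphere// sqrtr_gt0 subr_gt0.
by rewrite -(real_normK (num_real _)) expr_lt1.
Qed.

Lemma axial_slide {R : realType} m (x : 'rV[R]_m.+1) a : axial (slide x a) = a.
Proof. by rewrite axialD !axialZ axial_axis axial_offaxis mulr0 addr0 mulr1. Qed.

Lemma offaxis_slide {R : realType} m (x : 'rV[R]_m.+1) a :
  offaxis (slide x a) = (Num.sqrt (1 - a ^+ 2) / enorm (offaxis x)) *: offaxis x.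
Proof. by rewrite {1}/offaxis axial_slide /slide addrC addKr. Qed.

Lemma slide_sphere {R : realType} m (x : 'rV[R]_m.+1) a :
  `|a| = 1 \/ `|a| <= 1 /\ 0 < enorm (offaxis x) -> ideal_sphere R m (slide x a).
Proof.
have sqr : enorm (slide x a) ^+ 2 = a ^+ 2 + enorm (offaxis (slide x a)) ^+ 2.
  by rewrite offaxis_sqr axial_slide addrC subrK.
move=> ha; suff h : enorm (slide x a) ^+ 2 = 1.
  by rewrite /ideal_sphere/= -[LHS]ger0_norm ?enorm_ge0// -sqrtr_sqr h sqrtr1.
rewrite sqr offaxis_slide enormZ.
case: ha => [a1|[a1 x0]].
  by rewrite -(real_normK (num_real a)) a1 expr1n subrr sqrtr0 mul0r normr0 mul0r expr0n addr0.
have a2 : 0 <= 1 - a ^+ 2 by rewrite subr_ge0 -(real_normK (num_real a)) expr_le1.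
rewrite ger0_norm ?divr_ge0 ?sqrtr_ge0 ?ltW// divfK ?gt_eqF// sqr_sqrtr//.
by rewrite addrC subrK.
Qed.

Lemma slide_slide {R : realType} m (x : 'rV[R]_m.+1) a b :
  0 < enorm (offaxis x) -> `|a| < 1 -> slide (slide x a) b = slide x b.
Proof.
move=> x0 a1; rewrite {1}/slide offaxis_slide enormZ scalerA /slide; congr (_ + _ *: _).
have s0 : 0 < Num.sqrt (1 - a ^+ 2).
  by rewrite sqrtr_gt0 subr_gt0 -(real_normK (num_real a)) expr_lt1.
rewrite gtr0_norm ?divr_gt0//; field.
by rewrite !gt_eqF.
Qed.

Lemma slide_id {R : realType} m (x : 'rV[R]_m.+1) :
  ideal_sphere R m x -> slide x (axial x) = x.
Proof.
move=> x1; rewrite [RHS]axis_decomposition /slide; congr (_ + _).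
rewrite -offaxis_sphere//; have [z0|z0] := eqVneq (enorm (offaxis x)) 0.
  by move/eqP: z0; rewrite enorm_eq0 => /eqP ->; rewrite scaler0.
by rewrite divff// scale1r.
Qed.

Lemma slide_dist {R : realType} m (x : 'rV[R]_m.+1) a :
  ideal_sphere R m x -> `|axial x| < 1 -> `|a| <= 1 ->
  enorm (slide x a - x) <= `|a - axial x| * (1 + 2 / (1 - axial x ^+ 2)).
Proof.
move=> x1 c1 a1; set c := axial x.
have n0 := offaxis_gt0 x1 c1; set n := enorm (offaxis x) in n0.
have nn : n ^+ 2 = 1 - c ^+ 2 by rewrite offaxis_sqr x1 expr1n.
have n1 : n <= 1 by rewrite -x1 offaxis_le.
have a2 : 0 <= 1 - a ^+ 2 by rewrite subr_ge0 -(real_normK (num_real a)) expr_le1.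
pose s := Num.sqrt (1 - a ^+ 2).
have s0 : 0 <= s by exact: sqrtr_ge0.
have ss : s ^+ 2 = 1 - a ^+ 2 by rewrite sqr_sqrtr.
rewrite {2}[x]axis_decomposition -/c /slide opprD addrACA -scalerBl.
rewrite -[X in _ *: offaxis x - X]scale1r -scalerBl.
apply: le_trans (enormD _ _) _; rewrite !enormZ (edot_axis m).2 mulr1 mulrDr mulr1 lerD2l.
rewrite -/n -/s (_ : s / n - 1 = (s - n) / n); last by field; rewrite gt_eqF.
rewrite normrM (@ger0_norm _ n^-1) ?invr_ge0 ?(ltW n0)// divfK ?gt_eqF//.
rewrite -nn [leRHS]mulrA ler_pdivlMr ?exprn_gt0//.
apply: (@le_trans _ _ (`|s - n| * (s + n))).
  rewrite ler_wpM2l// expr2; nra.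
rewrite -(@ger0_norm _ (s + n)) ?addr_ge0 ?(ltW n0)// -normrM.
rewrite (_ : (s - n) * (s + n) = s ^+ 2 - n ^+ 2); last by ring.
rewrite ss nn (_ : _ - _ = - ((a - c) * (a + c))); last by ring.
rewrite normrN normrM ler_wpM2l//.
by apply: le_trans (ler_normD _ _) _; rewrite -/c in c1; lra.
Qed.

Lemma direction_dist {R : realType} n (u v : 'rV[R]_n) :
  0 < enorm u -> 0 < enorm v ->
  enorm ((enorm u)^-1 *: u - (enorm v)^-1 *: v) <= 2 * enorm (u - v) / enorm v.
Proof.
move=> u0 v0.
rewrite (_ : _ - _ = ((enorm u)^-1 - (enorm v)^-1) *: u + (enorm v)^-1 *: (u - v)); last first.
  by rewrite scalerBl scalerBr addrA subrK.
apply: le_trans (enormD _ _) _; rewrite !enormZ (@ger0_norm _ (enorm v)^-1) ?invr_ge0 ?(ltW v0)//.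
rewrite (_ : (enorm u)^-1 - _ = (enorm v - enorm u) / (enorm u * enorm v)); last first.
  by field; rewrite !gt_eqF.
rewrite normrM (@ger0_norm _ (_ * _)^-1) ?invr_ge0 ?mulr_ge0 ?enorm_ge0//.
rewrite (_ : _ * enorm u = `|enorm v - enorm u| / enorm v); last by field; rewrite !gt_eqF.
have h : `|enorm v - enorm u| <= enorm (u - v).
  by have := enorm_lipschitz v u; rewrite mul1r edistC.
rewrite (_ : 2 * _ / _ = enorm (u - v) / enorm v + (enorm v)^-1 * enorm (u - v)); last first.
  by field; rewrite gt_eqF.
by rewrite lerD2r ler_pM2r ?invr_gt0.
Qed.

Lemma slide_base_dist {R : realType} m (x y : 'rV[R]_m.+1) a : `|a| <= 1 ->
  0 < enorm (offaxis x) -> 0 < enorm (offaxis y) ->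
  enorm (slide y a - slide x a) <= 2 * enorm (y - x) / enorm (offaxis x).
Proof.
move=> a1 x0 y0; rewrite /slide opprD addrACA subrr add0r -!scalerA -scalerBr enormZ.
have a2 : 0 <= 1 - a ^+ 2 by rewrite subr_ge0 -(real_normK (num_real a)) expr_le1.
have s1 : Num.sqrt (1 - a ^+ 2) <= 1 by rewrite -[leRHS]sqrtr1 ler_wsqrtr// gerBl sqr_ge0.
rewrite ger0_norm ?sqrtr_ge0//; apply: le_trans (ler_piMl (enorm_ge0 _) s1) _.
apply: le_trans (direction_dist y0 x0) _.
by rewrite ler_pM2r ?invr_gt0// ler_pM2l// offaxisB offaxis_le.
Qed.

Definition latitude_map {R : realType} {m} (h : R -> R) (x : 'rV[R]_m.+1) :=
  slide x (h (axial x)).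

Lemma interval_map_le1 {R : realType} (h : R -> R) t :
  interval_map h -> `|t| <= 1 -> `|h t| <= 1.
Proof.
move=> [h1 hlt _]; rewrite le_eqVlt => /orP[/eqP t1|/hlt/ltW//].
by rewrite h1// t1.
Qed.

Lemma latitude_map_sphere {R : realType} m (h : R -> R) (x : 'rV[R]_m.+1) :
  interval_map h -> ideal_sphere R m x -> ideal_sphere R m (latitude_map h x).
Proof.
move=> hI x1; apply: slide_sphere; have [h1 hlt _] := hI.
have := axial_sphere x1; rewrite le_eqVlt => /orP[/eqP c1|c1].
  by left; rewrite h1.
by right; split; [exact/ltW/hlt|exact: offaxis_gt0].
Qed.

Lemma latitude_mapK {R : realType} m (h g : R -> R) (x : 'rV[R]_m.+1) :
  interval_map h -> interval_map g -> (forall t, `|t| <= 1 -> g (h t) = t) ->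
  ideal_sphere R m x -> latitude_map g (latitude_map h x) = x.
Proof.
move=> hI gI gh x1; have cx := axial_sphere x1; have [h1 hlt _] := hI.
rewrite /latitude_map axial_slide gh//.
move: (cx); rewrite le_eqVlt => /orP[/eqP c1|c1]; last first.
  by rewrite slide_slide ?slide_id// ?offaxis_gt0// hlt.
by rewrite h1// (slide_id x1) slide_id.
Qed.

(** At a pole the second term of [slide] tends to zero; elsewhere the map is
    compared with the slides of nearby points to one and the same latitude. *)
Lemma latitude_map_continuous {R : realType} m (h : R -> R) :
  interval_map h -> {within ideal_sphere R m, continuous (latitude_map h)}.
Proof.
move=> hI; apply/within_continuous_enormP => x x1 e e0.
have [h1 hlt hc] := hI; have cx := axial_sphere x1.
have [cx1|cx1] := ltP `|axial x| 1; last first.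
  have c1 : `|axial x| = 1 by apply/eqP; rewrite eq_le cx.
  have ax : offaxis x = 0.
    apply/eqP; rewrite -enorm_eq0 offaxis_sphere//.
    by rewrite -(real_normK (num_real _)) c1 expr1n subrr sqrtr0.
  have [d1 d10 hd1] := hc _ (e / 2) cx (divr_gt0 e0 (ltr0n _ 2)).
  have [d2 d20 hd2] := hc _ (e ^+ 2 / 8) cx (divr_gt0 (exprn_gt0 2 e0) (ltr0n _ 8)).
  exists (Num.min d1 d2); first by rewrite lt_min d10.
  move=> y y1; rewrite lt_min => /andP[yd1 yd2].
  have cy := axial_sphere y1.
  have {}hd1 := hd1 _ cy (le_lt_trans (axial_lipschitz _ _) yd1).
  have {}hd2 := hd2 _ cy (le_lt_trans (axial_lipschitz _ _) yd2).
  rewrite (h1 _ c1) in hd1 hd2.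
  rewrite {2}/latitude_map h1// slide_id// [x]axis_decomposition ax addr0.
  rewrite /latitude_map /slide addrAC -scalerBl.
  apply: le_lt_trans (enormD _ _) _; rewrite !enormZ (edot_axis m).2 mulr1.
  have ha := interval_map_le1 hI cy.
  have a2 : 0 <= 1 - h (axial y) ^+ 2.
    by rewrite subr_ge0 -(real_normK (num_real _)) expr_le1.
  suff : `|Num.sqrt (1 - h (axial y) ^+ 2) / enorm (offaxis y)| * enorm (offaxis y) < e / 2 by lra.
  have [->|z0] := eqVneq (enorm (offaxis y)) 0; first by rewrite mulr0 divr_gt0.
  rewrite normrM normfV (@ger0_norm _ (enorm _)) ?enorm_ge0// divfK// ger0_norm ?sqrtr_ge0//.
  rewrite -(@ltr_pXn2r _ 2)// ?nnegrE ?sqrtr_ge0 ?divr_ge0 ?(ltW e0)// sqr_sqrtr//.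
  have -> : 1 - h (axial y) ^+ 2 = - ((h (axial y) - axial x) * (h (axial y) + axial x)).
    by rewrite -[1](expr1n R 2) -c1 (real_normK (num_real _)); ring.
  apply: le_lt_trans (ler_norm _) _; rewrite normrN normrM.
  have h2 : `|h (axial y) + axial x| <= 2 by apply: le_trans (ler_normD _ _) _; lra.
  apply: (@le_lt_trans _ _ (`|h (axial y) - axial x| * 2)); first by rewrite ler_wpM2l.
  by rewrite expr_div_n; lra.
have nx := offaxis_gt0 x1 cx1; set n := enorm (offaxis x) in nx.
pose a := h (axial x); have a1 : `|a| < 1 by exact: hlt.
pose K := 1 + 2 / (1 - a ^+ 2).
have a2 : 0 < 1 - a ^+ 2 by rewrite subr_gt0 -(real_normK (num_real a)) expr_lt1.
have K0 : 0 < K by rewrite addr_gt0// divr_gt0.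
have [d1 d10 hd1] := hc _ (e / 2 / K) cx (divr_gt0 (divr_gt0 e0 (ltr0n _ 2)) K0).
exists (Num.min (1 - `|axial x|) (Num.min d1 (e * n / 4))).
  by rewrite !lt_min subr_gt0 cx1 d10/= divr_gt0// mulr_gt0.
move=> y y1; rewrite !lt_min => /and3P[yc yd ye].
have cyx := axial_lipschitz y x.
have cy1 : `|axial y| < 1.
  by have := ler_normD (axial y - axial x) (axial x); rewrite subrK; lra.
have ny := offaxis_gt0 y1 cy1.
apply: le_lt_trans (edist_trans (slide y a) _ _) _.
have l1 : enorm (latitude_map h y - slide y a) < e / 2.
  rewrite /latitude_map -(slide_slide _ ny a1).
  have S1 : ideal_sphere R m (slide y a) by apply: slide_sphere; right; rewrite ltW.
  have b1 := interval_map_le1 hI (ltW cy1).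
  have := slide_dist S1; rewrite axial_slide => /(_ _ a1 b1) /le_lt_trans; apply.
  rewrite -ltr_pdivlMr//; apply: hd1; first exact: ltW.
  exact: le_lt_trans cyx yd.
have l2 : enorm (slide y a - latitude_map h x) <= e / 2.
  apply: le_trans (slide_base_dist (ltW a1) nx ny) _.
  by rewrite ler_pdivrMr//; move: ye; rewrite ltr_pdivlMr// -/n; lra.
by rewrite (splitr e); exact: (ltr_leD l1 l2).
Qed.

Lemma latitude_map_homeomorphism {R : realType} m (h g : R -> R) :
  interval_map h -> interval_map g -> (forall t, `|t| <= 1 -> g (h t) = t) ->
  (forall t, `|t| <= 1 -> h (g t) = t) ->
  self_homeomorphism (ideal_sphere R m) (latitude_map h).
Proof.
move=> hI gI gh hg; split; last first.
- exists (latitude_map g); split=> [x x1|x x1|]; last exact: latitude_map_continuous.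
    by split; [exact: latitude_map_sphere|exact: latitude_mapK].
  exact: latitude_mapK.
- exact: latitude_map_continuous.
split.
- by move=> x; exact: latitude_map_sphere.
- move=> x y /set_mem x1 /set_mem y1 xy.
  by rewrite -(latitude_mapK hI gI gh x1) xy latitude_mapK.
- move=> x x1; exists (latitude_map g x); first exact: latitude_map_sphere.
  exact: latitude_mapK.
Qed.

Definition latitude_set (R : realType) m (B : set R) :=
  ideal_sphere R m `&` axial @^-1` B.
Arguments latitude_set {R} m B.

Lemma latitude_map_set {R : realType} m (h g : R -> R) (B : set R) :
  interval_map h -> interval_map g -> (forall t, `|t| <= 1 -> g (h t) = t) ->
  (forall t, `|t| <= 1 -> h (g t) = t) -> (forall t, B t -> `|t| <= 1) ->
  latitude_map h @` latitude_set m B = latitude_set m (h @` B).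
Proof.
move=> hI gI gh hg B1; apply/seteqP; split=> x.
  move=> [y [y1 /= By] <-]; split; first exact: latitude_map_sphere.
  by rewrite /= axial_slide; exists (axial y).
move=> [x1 /= [t Bt tx]]; exists (latitude_map g x); last exact: latitude_mapK.
split; first exact: latitude_map_sphere.
by rewrite /= axial_slide -tx gh ?B1.
Qed.

(** * A conical limit set and its image *)

Definition decimals {R : realType} : set R := range (@sdecimal R).

Lemma decimals_le1 {R : realType} (t : R) : decimals t -> `|t| < 1.
Proof.
move=> [s _ <-]; apply: le_lt_trans (sdecimal_bound s) _.
by rewrite ltr_pdivrMr// mul1r ltr1n.
Qed.

Definition decimal_seq {R : realType} (j : nat) : R :=
  sdecimal (odflt [::] (unpickle j)).

Lemma decimal_seq_pickle {R : realType} s : decimal_seq (pickle s) = sdecimal s :> R.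
Proof. by rewrite /decimal_seq pickleK. Qed.

Lemma pow10_scale {R : realType} N (rho : R) : 0 < rho -> rho <= 1 / 10 ^+ N ->
  exists2 k, (N <= k)%N & rho <= 1 / 10 ^+ k <= 10 * rho.
Proof.
move=> rho0 rhoN.
have exP : exists i, 1 / 10 ^+ i < rho.
  exists (Num.truncn rho^-1).+1; rewrite div1r invf_plt ?posrE ?exprn_gt0//.
  apply: lt_trans (truncnS_gt _) _; rewrite -natrX ltr_nat; exact: ltn_expl.
case: (ex_minnP exP) => i hi imin.
have Ni : (N < i)%N.
  rewrite ltnNge; apply/negP => iN; move: hi; rewrite ltNge => /negP; apply.
  apply: le_trans rhoN _; rewrite !div1r lef_pV2 ?posrE ?exprn_gt0//.
  by rewrite ler_eXn2l// ltr1n.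
case: i hi imin Ni => // k hk kmin Nk; exists k => //.
apply/andP; split.
  by rewrite leNgt; apply/negP => /kmin; rewrite ltnn.
by move: hk; rewrite exprS invfM mulrA; lra.
Qed.

(** The slices of the sphere over the signed decimals are reached through the
    holes that the set of signed decimals has near each of its points, at all
    small scales. *)
Lemma decimals_CL {R : realType} m : CL R m (latitude_set m decimals).
Proof.
pose Y := latitude_set m (closure (@decimals R)).
pose U j k := [set x : 'rV[R]_m.+1 | `|axial x - decimal_seq j| < k.+1%:R^-1].
have Uj j (x : 'rV[R]_m.+1) : (\bigcap_k U j k) x -> axial x = decimal_seq j.
  move=> Ux; apply/eqP; rewrite -subr_eq0 -normr_eq0 eq_le normr_ge0 andbT leNgt.
  apply/negP => n0; have := Ux (Num.truncn `|axial x - decimal_seq j|^-1) I.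
  rewrite /U/= invf_pgt ?posrE// => /(lt_trans (truncnS_gt _)).
  by rewrite ltxx.
have -> : latitude_set m decimals = \bigcup_(j in setT) (Y `&` \bigcap_k U j k).
  apply/seteqP; split=> x.
    move=> [x1 /= [s _ sx]]; exists (pickle s) => //; split.
      by split=> //; apply: subset_closure; exists s.
    by move=> k _; rewrite /U/= decimal_seq_pickle -sx subrr normr0 invr_gt0.
  by move=> [j _ [[x1 _] /Uj xj]]; split=> //=; rewrite xj; eexists.
apply: conical_limit_realization.
- apply: closedI; first exact: ideal_sphere_closed.
  apply: (lipschitz_preimage_closed (phi := axial) (K := 1)); last exact: closed_closure.
  by move=> u v; rewrite mul1r axial_lipschitz.
- by move=> x [].
- move=> j k; apply/open_enormP => x xU; exists (k.+1%:R^-1 - `|axial x - decimal_seq j|).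
    by rewrite subr_gt0.
  move=> y; rewrite ltrBrDr => yx; apply: le_lt_trans yx.
  rewrite -[X in `|X|](subrKA (axial x)); apply: le_trans (ler_normD _ _) _.
  by rewrite lerD2r axial_lipschitz.
- move=> j k l kl x; rewrite /U/= => /lt_le_trans; apply.
  by rewrite lef_pV2 ?posrE ?ler_nat.
move=> j _; set s := odflt [::] (@unpickle (seq (option bool)) j).
have c1 : decimal_seq j ^+ 2 < 1 :> R.
  rewrite -(real_normK (num_real _)) expr_lt1//; apply: decimals_le1; by exists s.
have D0 : 0 <= 20 * j.+1%:R :> R by rewrite mulr_ge0.
have [L [r0 [L0 r00 hL]]] := displaced_point (edot_axis m).2 c1 D0.
pose N := size s; have j0 : 0 < 5 * j.+1%:R :> R by rewrite mulr_gt0.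
exists L, (Num.min r0 (1 / 10 ^+ N / (5 * j.+1%:R))); split=> //.
  by rewrite lt_min r00 !divr_gt0// exprn_gt0.
move=> y r [[y1 _] /Uj yj] rpos; rewrite le_min => /andP[rr0].
rewrite ler_pdivlMr// => rN.
(* the hole centred at [decimal_seq j + 2 / 5 / 10 ^+ k] has radius at least
   [1 / 5 / 10 ^+ k], which [k] makes comparable to [j.+1 * r] *)
have [|k Nk /andP[k1 k2]] := pow10_scale _ rN; first by rewrite mulr_gt0.
have p0 : 0 < 1 / 10 ^+ k :> R by rewrite divr_gt0// exprn_gt0.
have [|z [zc zy z1 z2]] := hL y (2 / 5 / 10 ^+ k) r y1 yj rpos rr0.
  have -> : 2 / 5 / 10 ^+ k = 2 / 5 * (1 / 10 ^+ k) :> R by rewrite mul1r.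
  by rewrite ger0_norm; [lra|rewrite mulr_ge0// ltW].
exists z; split=> // x [_ /= xA].
apply: le_trans (axial_lipschitz z x); rewrite [axial z]zc.
pose p : R := decimal_seq j + 2 / 5 / 10 ^+ k.
have : closure decimals `<=` [set t | 1 / 5 / 10 ^+ k <= `|p - t|].
  rewrite [X in _ `<=` X](closure_id _).1; last first.
    apply: (@closed_comp _ _ (fun t => `|p - t|) [set u | 1 / 5 / 10 ^+ k <= u]).
      move=> t _; apply: (@continuous_comp _ _ _ (fun t => p - t) (fun u => `|u|)).
        by apply: cvgB; [exact: cvg_cst|exact: cvg_id].
      exact: norm_continuous.
    exact: closed_ge.
  apply: closure_subset => _ [u _ <-] /=; rewrite /p -normrN opprB opprD addrA.
  exact: sdecimal_hole.
move=> /(_ _ xA) /=; apply: le_trans.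
have -> : 1 / 5 / 10 ^+ k = 1 / 5 * (1 / 10 ^+ k) :> R by rewrite mulrA mulr1.
by lra.
Qed.

(** The Baire category argument in the closure of [D], by shrinking balls centred
    at points of [D]. *)
Lemma meets_dense_open {R : realType} n (D : set 'rV[R]_n) (O : nat -> set 'rV[R]_n) :
  D !=set0 -> (forall k, open (O k)) ->
  (forall k a e, D a -> 0 < e -> exists b, [/\ D b, enorm (b - a) < e & O k b]) ->
  exists2 x, closure D x & forall k, O k x.
Proof.
move=> [a0 Da0] oO hD.
pose next k (p q : 'rV[R]_n * R) := [/\ D q.1, 0 < q.2, q.2 <= p.2 / 2 &
  forall v, enorm (v - q.1) <= q.2 -> enorm (v - p.1) <= p.2 /\ O k v].
have /choice[f hf] : forall kp : nat * ('rV[R]_n * R), exists q,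
    D kp.2.1 -> 0 < kp.2.2 -> next kp.1 kp.2 q.
  move=> [k [a r]] /=; have [[Da r0]|nDr] := pselect (D a /\ 0 < r); last first.
    by exists (a, r) => Da r0; case: nDr.
  have [|b [Db ba Ob]] := hD k a (r / 2) Da; first by rewrite divr_gt0.
  have /open_enormP/(_ _ Ob)[rho rho0 hrho] := oO k.
  exists (b, Num.min (r / 2) (rho / 2)) => _ _; split=> //=.
  - by rewrite lt_min !divr_gt0.
  - by rewrite ge_min lexx.
  move=> v; rewrite le_min => /andP[v1 v2]; split.
    by apply: le_trans (edist_trans b _ _) _; lra.
  by apply: hrho; lra.
pose fix ar k := if k is l.+1 then f (l, ar l) else (a0, 1).
have inv k : D (ar k).1 /\ 0 < (ar k).2.
  by elim: k => [|k [Dk rk]]; [split|have [] := hf (k, ar k) Dk rk].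
have step k : next k (ar k) (ar k.+1) by have [Dk rk] := inv k; exact: hf.
have small k : (ar k).2 <= 1 / 2 ^+ k.
  elim: k => [|k ih]; first by rewrite expr0 divr1.
  have [_ _ h _] := step k; apply: le_trans h _.
  by rewrite exprS invfM mulrA mulrAC ler_pM2r ?invr_gt0.
have nested k l v : enorm (v - (ar (l + k)%N).1) <= (ar (l + k)%N).2 ->
    enorm (v - (ar k).1) <= (ar k).2.
  elim: l => [//|l ih] /=; have [_ _ _ h] := step (l + k)%N.
  by move=> /h[/ih].
have near k l : (k <= l)%N -> enorm ((ar l).1 - (ar k).1) <= (ar k).2.
  move=> kl; apply: (nested k (l - k)%N); rewrite subnK// subrr enorm0.
  by have [_ /ltW] := inv l.
have ex_small (e : R) : 0 < e -> exists k, (ar k).2 < e.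
  move=> e0; exists (Num.truncn e^-1).+1; apply: le_lt_trans (small _) _.
  rewrite div1r invf_plt ?posrE ?exprn_gt0//; apply: lt_trans (truncnS_gt _) _.
  by rewrite -natrX ltr_nat ltn_expl.
have : cvgn (fun k => (ar k).1).
  apply: cauchy_cvg; apply: cauchy_exP => e e0; have [k ke] := ex_small e e0.
  exists (ar k).1, k => // l /= kl; split=> // i j; rewrite /ball/= distrC.
  apply: le_lt_trans ke; apply: le_trans (near k l kl).
  by rewrite (ord1 i) (_ : _ - _ = ((ar l).1 - (ar k).1) 0 j) ?coord_le_enorm// !mxE.
move=> /cvg_ex[x /cvg_enormP hx].
have xk k : enorm (x - (ar k).1) <= (ar k).2.
  apply/ler_addgt0Pr => e e0; have [M _ hM] := hx e e0.
  have := hM (maxn M k) (leq_maxl _ _); rewrite /= edistC => h.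
  apply: le_trans (edist_trans (ar (maxn M k)).1 _ _) _.
  by rewrite addrC; apply: lerD; [apply: near; exact: leq_maxr|exact: ltW].
exists x.
  move=> B /nbhs_enormP[e e0 eB]; have [k ke] := ex_small e e0.
  exists (ar k).1; split; first by have [] := inv k.
  by apply: eB; rewrite edistC; exact: le_lt_trans (xk k) ke.
move=> k; have [_ _ _ h] := step k.
by have [] := h _ (xk k.+1).
Qed.

(** The negation of porosity: near a point of [B], the gaps of [B] are negligible
    compared with their distance to that point. *)
Definition nonporous {R : realType} (B : set R) := forall b, B b ->
  forall e, 0 < e -> exists2 s0, 0 < s0 & forall u, `|u - b| < s0 ->
    exists2 b', B b' & `|b' - u| <= e * `|u - b|.

(** Suppose that the latitude set is the conical limit set of [E].  At each of its
    points some cone, of uncontrolled aperture, contains points [z] of [E]; by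
    non-porosity such a [z] lies in the cone of aperture 3 at a nearby point of
    the set.  Hence the points [x] of the closure for which the cone of aperture
    3 contains points of [E] arbitrarily close to [x] are generic, and they
    belong to the set.  But the set is a countable union of slices, which are
    nowhere dense in its closure. *)
Lemma nonporous_not_CL {R : realType} m (q : nat -> R) : (1 <= m)%N ->
  (forall i, `|q i| < 1) -> nonporous (range q) ->
  (forall i k e, 0 < e -> exists l, q l != q k /\ `|q l - q i| < e) ->
  ~ CL R m (latitude_set m (range q)).
Proof.
move=> m1 q1 np dense [E EH]; rewrite conical_limitP// => ES.
set L := latitude_set m (range q) in ES.
pose O k := [set x : 'rV[R]_m.+1 | exists z,
   [/\ E z, 1 - enorm z < k.+1%:R^-1 & enorm (z - x) < 3 * (1 - enorm z)]] `&`
  [set x | axial x != q k].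
have L0 : L !=set0.
  pose v : 'rV[R]_m.+1 := delta_mx 0 (inord 1).
  have v0 : axial v = 0.
    rewrite /axial /edot big1// => i _; rewrite !mxE eqxx/=.
    have [->|] := eqVneq i 0; last by rewrite mulr0.
    by rewrite -val_eqE/= inordK// mul0r.
  have vo : 0 < enorm (offaxis v).
    rewrite /offaxis v0 scale0r subr0 lt_neqAle enorm_ge0 andbT eq_sym enorm_eq0.
    apply/eqP => /rowP/(_ (inord 1)); rewrite !mxE !eqxx/= => /eqP; rewrite oner_eq0//.
  exists (slide v (q 0%N)); split; last by rewrite /= axial_slide; exists 0%N.
  by apply: slide_sphere; right; split=> //; exact/ltW/q1.
have oO k : open (O k).
  apply: openI.
    apply/open_enormP => x [z [Ez z1 z2]].
    exists (3 * (1 - enorm z) - enorm (z - x)); first by rewrite subr_gt0.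
    move=> y yx; exists z; split=> //; apply: le_lt_trans (edist_trans x _ _) _.
    by rewrite (edistC x) -ltrBrDl.
  apply/open_enormP => x /= xq; exists `|axial x - q k|; first by rewrite normr_gt0 subr_eq0.
  move=> y yx; apply/eqP => yq; move: yx; rewrite ltNge => /negP; apply.
  by rewrite -yq distrC axial_lipschitz.
have [x xL xO] : exists2 x, closure L x & forall k, O k x.
  apply: meets_dense_open => // k a e La e0.
  have [a1 [C hC]] : [set x | enorm x = 1 /\ conical_point E x] a by rewrite ES.
  have [_ /= [i _ qi]] := La.
  have C0 : 0 < `|C| + 1 by rewrite ltr_wpDl.
  have ca1 : `|axial a| < 1 by rewrite -qi.
  have gap0 : 0 < 1 - `|axial a| by rewrite subr_gt0.
  pose kap := 1 - ((1 + `|axial a|) / 2) ^+ 2.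
  have kap0 : 0 < kap by rewrite subr_gt0 expr_lt1//; lra.
  pose K := 1 + 2 / kap; have K0 : 0 < K by rewrite addr_gt0// divr_gt0.
  (* nearby points keep their distance to the poles *)
  have slideK w u : ideal_sphere R m w -> `|u| < 1 -> `|axial w - axial a| < (1 - `|axial a|) / 2 ->
      enorm (slide w u - w) <= K * `|u - axial w|.
    move=> w1 u1 wa; have cw : `|axial w| <= (1 + `|axial a|) / 2.
      by have := ler_normD (axial w - axial a) (axial a); rewrite subrK; lra.
    have cw1 : `|axial w| < 1 by lra.
    apply: le_trans (slide_dist w1 cw1 (ltW u1)) _; rewrite mulrC ler_wpM2r// lerD2l.
    rewrite ler_pM2l// lef_pV2 ?posrE//; last first.
      by rewrite subr_gt0 -(real_normK (num_real _)) expr_lt1.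
    rewrite lerD2l lerN2 -(real_normK (num_real _)) ler_pXn2r ?nnegrE//; lra.
  have slideS w u : ideal_sphere R m w -> `|u| < 1 -> `|axial w - axial a| < (1 - `|axial a|) / 2 ->
      ideal_sphere R m (slide w u).
    move=> w1 u1 wa; apply: slide_sphere; right; split; first exact: ltW.
    apply: offaxis_gt0 => //.
    by have := ler_normD (axial w - axial a) (axial a); rewrite subrK; lra.
  have KC0 : 0 < (K * (`|C| + 1))^-1 by rewrite invr_gt0 mulr_gt0.
  have [s0 s00 hs0] := np (axial a) La.2 _ KC0.
  pose g := Num.min ((1 - `|axial a|) / 2) s0.
  have g0 : 0 < g by rewrite lt_min divr_gt0.
  pose eta := Num.min (Num.min (g / (`|C| + 1)) (e / 2 / (`|C| + 3))) k.+1%:R^-1.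
  have C3 : 0 < `|C| + 3 by rewrite ltr_wpDl.
  have eta0 : 0 < eta by rewrite !lt_min !divr_gt0//= invr_gt0.
  have [z [Ez za zC]] := hC eta eta0.
  have z1 : 0 < 1 - enorm z by rewrite subr_gt0; exact: EH.
  set r := 1 - enorm z in zC z1.
  have ra : r <= enorm (z - a).
    by have := ler_enorm_dist a z; rewrite a1 (edistC a).
  move: za; rewrite !lt_min -andbA => /and3P[za1 za2 za3].
  have za_r : enorm (z - a) <= `|C| * r.
    by apply: le_trans zC _; rewrite ler_wpM2r ?ler_norm// ltW.
  have [w w1 wz] : exists2 w, ideal_sphere R m w & enorm (w - z) <= r.
    have [z0|zn0] := eqVneq z 0.
      by exists a => //; rewrite z0 subr0 a1 /r z0 enorm0 subr0.
    have nz : 0 < enorm z by rewrite lt_neqAle enorm_ge0 eq_sym enorm_eq0 zn0.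
    exists ((enorm z)^-1 *: z).
      by rewrite /ideal_sphere/= enormZ gtr0_norm ?invr_gt0// mulVf// gt_eqF.
    rewrite -{3}(scale1r z) -scalerBl enormZ.
    rewrite (_ : _ - 1 = r / enorm z); last by rewrite /r; field; rewrite gt_eqF.
    by rewrite gtr0_norm ?divr_gt0// divfK// gt_eqF.
  have wa : enorm (w - a) <= (`|C| + 1) * r.
    by apply: le_trans (edist_trans z _ _) _; rewrite mulrDl mul1r addrC lerD.
  have rg : (`|C| + 1) * r < g.
    by rewrite mulrC -ltr_pdivlMr//; exact: le_lt_trans za1.
  have cwa : `|axial w - axial a| < g.
    exact: le_lt_trans (axial_lipschitz _ _) (le_lt_trans wa rg).
  have [cw1 cw2] : `|axial w - axial a| < (1 - `|axial a|) / 2 /\ `|axial w - axial a| < s0.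
    by move: cwa; rewrite lt_min => /andP[].
  have [_ [l _ <-] hl] := hs0 _ cw2.
  pose b := slide w (q l).
  have bw : enorm (b - w) <= r.
    apply: le_trans (slideK _ _ w1 (q1 l) cw1) _.
    apply: (@le_trans _ _ (K * ((K * (`|C| + 1))^-1 * ((`|C| + 1) * r)))).
      rewrite ler_pM2l//; apply: le_trans hl _; rewrite ler_pM2l ?invr_gt0 ?mulr_gt0//.
      exact: le_trans (axial_lipschitz _ _) wa.
    by rewrite le_eqVlt; apply/orP; left; apply/eqP; field; rewrite !gt_eqF.
  have Lb : L b.
    by split; [exact: slideS|rewrite /= axial_slide; exists l].
  have ba : enorm (b - a) < e / 2.
    apply: le_lt_trans (edist_trans w _ _) _.
    apply: (@le_lt_trans _ _ ((`|C| + 3) * r)).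
      rewrite (_ : _ * r = r + ((`|C| + 1) * r + r)); last by ring.
      by rewrite lerD// (le_trans wa)// lerDl ltW.
    by rewrite mulrC -ltr_pdivlMr//; exact: le_lt_trans za2.
  have bz : enorm (z - b) < 3 * r.
    apply: le_lt_trans (edist_trans w _ _) _; rewrite (edistC z) (edistC w b).
    by apply: le_lt_trans (lerD wz bw) _; move: z1; clear; lra.
  have [bq|bq] := eqVneq (q l) (q k); last first.
    exists b; split; [exact: Lb|by apply: lt_trans ba _; rewrite ltr_pdivrMr// ltr_pMr// ltr1n|].
    split; last by rewrite /= axial_slide.
    by exists z; split; [exact: Ez|exact: le_lt_trans ra za3|exact: bz].
  (* move [b] off the slice of [q k], within the open condition *)
  have b1 : ideal_sphere R m b := Lb.1.
  have cb1 : `|axial b| < 1 by rewrite axial_slide.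
  pose Kb := 1 + 2 / (1 - axial b ^+ 2).
  have Kb0 : 0 < Kb.
    rewrite addr_gt0// divr_gt0// subr_gt0 -(real_normK (num_real _)) expr_lt1//.
  pose del := Num.min (e / 2) (3 * r - enorm (z - b)) / Kb.
  have del0 : 0 < del by rewrite divr_gt0// lt_min divr_gt0// subr_gt0.
  have [l' [ql' ll']] := dense l k del del0.
  have b'b : enorm (slide b (q l') - b) < Num.min (e / 2) (3 * r - enorm (z - b)).
    apply: le_lt_trans (slide_dist b1 cb1 (ltW (q1 l'))) _.
    by rewrite -/Kb -ltr_pdivlMr// {1}axial_slide; exact: ll'.
  move: b'b; rewrite lt_min => /andP[b'1 b'2].
  exists (slide b (q l')); split.
  - split; last by rewrite /= axial_slide; exists l'.
    by apply: slide_sphere; right; split; [exact: ltW|exact: offaxis_gt0].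
  - by apply: le_lt_trans (edist_trans b _ _) _; rewrite (splitr e) ltrD.
  split; last by rewrite /= axial_slide.
  exists z; split; [exact: Ez|exact: le_lt_trans ra za3|].
  apply: le_lt_trans (edist_trans b _ _) _.
  by rewrite -/r -ltrBrDl (edistC b).
have x1 : ideal_sphere R m x.
  have : closure L `<=` ideal_sphere R m.
    rewrite [X in _ `<=` X](closure_id _).1; last exact: ideal_sphere_closed.
    by apply: closure_subset => y [].
  exact.
have : L x.
  rewrite -ES; split=> //; exists 3 => e e0.
  have [k hk] : exists k : nat, k.+1%:R^-1 < e / 3.
    exists (Num.truncn (e / 3)^-1); rewrite invf_plt ?posrE ?divr_gt0//; exact: truncnS_gt.
  have [[z [Ez z1 z2]] _] := xO k; exists z; split=> //; last exact: ltW.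
  by move: (lt_trans z1 hk) z2 => {z1 hk}; lra.
by move=> [_ /= [k _ qx]]; have [_ /eqP] := xO k; rewrite -qx.
Qed.

(** The signed decimals contain [b + 1 / 10 ^+ k.+1] and [b - 1 / 10 ^+ k.+1] for
    large [k] together with [b]; slow variation brings the images of these points
    close to each other. *)
Lemma slowly_varying_nonporous {R : realType} (h : R -> R) :
  (forall x y, x < y -> h x < h y) ->
  (forall x e, 0 < e -> exists2 d, 0 < d & forall y, `|y - x| < d -> `|h y - h x| < e) ->
  (forall i, slowly_varying (fun t => h (decimal_seq i + t) - h (decimal_seq i))) ->
  (forall i, slowly_varying (fun t => h (decimal_seq i) - h (decimal_seq i - t))) ->
  nonporous (range (h \o decimal_seq)).
Proof.
move=> hlt hc hp hm _ [i _ <-] e e0 /=.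
set s := odflt [::] (@unpickle (seq (option bool)) i).
have small (u : R) : 0 < u -> exists2 d, 0 < d & forall t, 0 < t -> t < d ->
    `|h (decimal_seq i + t) - h (decimal_seq i)| < u /\
    `|h (decimal_seq i) - h (decimal_seq i - t)| < u.
  move=> u0; have [d d0 hd] := hc (decimal_seq i) u u0; exists d => // t t0 td.
  rewrite [X in _ /\ X < _]distrC; split; apply: hd.
    by rewrite addrAC subrr add0r gtr0_norm.
  by rewrite addrAC subrr add0r normrN gtr0_norm.
have [|u u0|sp sp0 hsp] := slowly_varying_hits (size s) _ _ (hp i) e0.
- by move=> t t0; rewrite subr_gt0 hlt// ltrDl.
- by have [d d0 hd] := small u u0; exists d => // t t0 /(hd _ t0)[/ltr_normlW].
have [|u u0|sm sm0 hsm] := slowly_varying_hits (size s) _ _ (hm i) e0.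
- by move=> t t0; rewrite subr_gt0 hlt// gtrBl.
- by have [d d0 hd] := small u u0; exists d => // t t0 /(hd _ t0)[_ /ltr_normlW].
have mem t : range (h \o decimal_seq) (h (sdecimal t)).
  by exists (pickle t) => //=; rewrite decimal_seq_pickle.
exists (Num.min sp sm) => [|u]; first by rewrite lt_min sp0.
rewrite lt_min => /andP[]; case: (ltgtP u (h (decimal_seq i))) => [ui|ui|->] up um.
- have [||k sk hk] := hsm (h (decimal_seq i) - u).
  + by rewrite subr_gt0.
  + by move: um; rewrite distrC gtr0_norm ?subr_gt0.
  have [t ht] := @sdecimal_neighbour R s k false sk.
  exists (h (sdecimal t)); first exact: mem.
  rewrite ht/= mulN1r -/(decimal_seq i) (distrC u).
  rewrite (@gtr0_norm _ (h (decimal_seq i) - u)) ?subr_gt0//.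
  apply: le_trans hk; rewrite div1r -normrN le_eqVlt; apply/orP; left; apply/eqP.
  by congr `|_|; ring.
- have [||k sk hk] := hsp (u - h (decimal_seq i)).
  + by rewrite subr_gt0.
  + by move: up; rewrite gtr0_norm ?subr_gt0.
  have [t ht] := @sdecimal_neighbour R s k true sk.
  exists (h (sdecimal t)); first exact: mem.
  rewrite ht/= -/(decimal_seq i) (@gtr0_norm _ (u - _)) ?subr_gt0//.
  apply: le_trans hk; rewrite le_eqVlt; apply/orP; left; apply/eqP.
  by congr `|_|; ring.
- exists (h (decimal_seq i)); first by exists i.
  by rewrite !subrr normr0 mulr0.
Qed.

(** The homeomorphism closes the holes of the signed decimals, in relative size,
    at each of their points. *)
Lemma CL_not_invariant {R : realType} m : (1 <= m)%N ->
  exists f : 'rV[R]_m.+1 -> 'rV[R]_m.+1,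
    self_homeomorphism (ideal_sphere R m) f /\
    exists A : set 'rV[R]_m.+1, CL R m A /\ ~ CL R m (f @` A).
Proof.
move=> m1; have [h [hlt [h1 hN1] hc hp hm]] := @normalized_slow_sum R decimal_seq.
have [g [hI gI gh hg]] := interval_map_inverse hlt h1 hN1 hc.
exists (latitude_map h); split; first exact: latitude_map_homeomorphism gh hg.
exists (latitude_set m decimals); split; first exact: decimals_CL.
rewrite (latitude_map_set m hI gI gh hg); last by move=> t /decimals_le1/ltW.
have -> : h @` decimals = range (h \o decimal_seq).
  apply/seteqP; split=> y.
    by move=> [_ [s _ <-] <-]; exists (pickle s) => //=; rewrite decimal_seq_pickle.
  by move=> [j _ <-]; exists (decimal_seq j) => //; eexists.
apply: nonporous_not_CL => //.
- by move=> i /=; have [_ h2 _] := hI; apply/h2/decimals_le1; eexists.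
- exact: slowly_varying_nonporous.
move=> i k e e0 /=; have [ik|ik] := eqVneq (h (decimal_seq i)) (h (decimal_seq k)); last first.
  by exists i; rewrite subrr normr0.
have [d d0 hd] := hc (decimal_seq i) e e0.
set s := odflt [::] (@unpickle (seq (option bool)) i).
pose l := maxn (size s) (Num.truncn d^-1).
have [t ht] := @sdecimal_neighbour R s l true (leq_maxl _ _).
have p0 : 0 < 1 / 10 ^+ l.+1 :> R by rewrite divr_gt0// exprn_gt0.
exists (pickle t); rewrite decimal_seq_pickle ht -/(decimal_seq i) -ik; split.
  by rewrite gt_eqF// hlt// ltrDl.
apply: hd; rewrite addrAC subrr add0r gtr0_norm//= div1r invf_plt ?posrE ?exprn_gt0//.
apply: lt_trans (truncnS_gt _) _; rewrite -natrX ltr_nat.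
apply: (@leq_ltn_trans l.+1); first by rewrite ltnS leq_maxr.
exact: ltn_expl.
Qed.

(** * Invariance of Borel classes *)

Lemma Gdelta_homeomorphism {T : topologicalType} (X A : set T) (f : T -> T) :
  self_homeomorphism X f -> Gdelta_in X A -> Gdelta_in X (f @` A).
Proof.
move=> [[fX _ _] _ [g [gX gf gc]]] [AX [F oF AF]]; split.
  by move=> _ [x /AX/fX fx <-].
exists (fun k => (g @^-1` (F k `&` X)) `&` X) => [k|].
  have /open_subspaceP[V oV VX] := oF k.
  have -> : (g @^-1` (F k `&` X)) `&` X = (g @^-1` V) `&` X.
    rewrite -VX; apply/seteqP; split=> y [] /=; first by move=> [].
    by move=> gy Xy; split=> //; split=> //; case: (gX _ Xy).
  by rewrite open_subspaceIT; move/continuousP: gc; apply.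
apply/seteqP; split=> y.
  move=> [x Ax <-] k _; have Xx := AX _ Ax; split; last exact: fX.
  by rewrite /= gf//; split=> //; move: Ax; rewrite AF; apply.
move=> Gy; have [_ Xy] := Gy 0%N I; have [Xgy fgy] := gX _ Xy.
by exists (g y) => //; rewrite AF => k _; have [[]] := Gy k I.
Qed.

Lemma Gdelta_sigma_homeomorphism {T : topologicalType} (X A : set T) (f : T -> T) :
  self_homeomorphism X f -> Gdelta_sigma_in X A -> Gdelta_sigma_in X (f @` A).
Proof.
move=> fh [F FG ->]; exists (fun i => f @` F i); last by rewrite image_bigcup.
by move=> i; exact: Gdelta_homeomorphism.
Qed.

(** * The theorem *)

Theorem theorem1p2 (R : realType) (m : nat) (hm : (1 <= m)%N) :
  [/\ CL R m `<=` Gdelta_sigma_in (ideal_sphere R m) /\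
      CL R m <> Gdelta_sigma_in (ideal_sphere R m),
      Gdelta_in (ideal_sphere R m) `<=` CL R m /\
      Gdelta_in (ideal_sphere R m) <> CL R m,
      forall Y : set 'rV[R]_m.+1, codim1_sphere Y ->
        Gdelta_sigma_in Y `<=` CL R m &
      exists f : 'rV[R]_m.+1 -> 'rV[R]_m.+1,
        self_homeomorphism (ideal_sphere R m) f /\
        exists A : set 'rV[R]_m.+1, CL R m A /\ ~ CL R m (f @` A)].
Proof.
have [f [fh [A [AC fAC]]]] := @CL_not_invariant R m hm.
split.
- split; first exact: CL_sub_Gdelta_sigma.
  move=> E; apply: fAC; rewrite E; apply: Gdelta_sigma_homeomorphism => //.
  exact: CL_sub_Gdelta_sigma.
- split; first exact: Gdelta_sub_CL.
  by move=> E; apply: fAC; rewrite -E; apply: Gdelta_homeomorphism => //; rewrite E.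
- exact: Gdelta_sigma_codim1_sub_CL.
- by exists f; split=> //; exists A.
Qed.
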